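(* Let $A$ be a material coefficient field satisfying the assumptions in the context, let $\boldsymbol N\in\mathbb N^d$ have all components odd, and let $A_{\mathrm H},B_{\mathrm H}$ (continuous), $A_{\mathrm H,\boldsymbol N},B_{\mathrm H,\boldsymbol N}$ (Galerkin approximation) and $\widetilde A^{\mathrm{bound}}_{\mathrm H,\boldsymbol N},\widetilde B^{\mathrm{bound}}_{\mathrm H,\boldsymbol N}$ (a posteriori bounds from the Galerkin approximation with numerical integration) be the homogenized matrices defined in the context. Then $$\bigl(\widetilde B^{\mathrm{bound}}_{\mathrm H,\boldsymbol N}\bigr)^{-1}\preceq B_{\mathrm H,\boldsymbol N}^{-1}\preceq B_{\mathrm H}^{-1}=A_{\mathrm H}\preceq A_{\mathrm H,\boldsymbol N}\preceq \widetilde A^{\mathrm{bound}}_{\mathrm H,\boldsymbol N}.$$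
   Context: Let $d\in\{2,3\}$, $\mathcal Y=(-\tfrac12,\tfrac12)^d$. Functions on $\mathcal Y$ are understood as $\mathcal Y$-periodic (period lattice $\mathbb Z^d$); $L^p_\#(\mathcal Y;X)$ is the space of $\mathcal Y$-periodic $X$-valued $L^p$ functions, and $(u,v)_{L^2_\#}=\int_{\mathcal Y}u(x)\cdot v(x)\,dx$ on $L^2_\#(\mathcal Y;\mathbb R^d)$. Put $\varphi_k(x)=\exp(2\pi i\,k\cdot x)$, $\hat v(k)=\int_{\mathcal Y}v(x)\varphi_{-k}(x)\,dx$ for $k\in\mathbb Z^d$, and $\langle v\rangle=\hat v(0)$. Subspaces: $\mathcal E$ is the set of $v\in L^2_\#(\mathcal Y;\mathbb R^d)$ with $\langle v\rangle=0$ and $\operatorname{curl}v=0$, i.e. $k_\beta\hat v_\alpha(k)-k_\alpha\hat v_\beta(k)=0$ for all $k,\alpha,\beta$; $\mathcal J$ is the set of $v\in L^2_\#(\mathcal Y;\mathbb R^d)$ with $\langle v\rangle=0$ and $\operatorname{div}v=0$, i.e. $k\cdot\hat v(k)=0$ for all $k$. Vectors in $\mathbb R^d$ are identified with constant functions. Coefficients: $A:\mathcal Y\to\mathbb R^{d\times d}_{\mathrm{spd}}$ ($\mathbb R^{d\times d}_{\mathrm{spd}}$ = symmetric positive definite matrices) is in $L^\infty_\#$ and there are $0<c_A\le C_A<\infty$ with $c_A\|v\|^2\le A(x)v\cdot v\le C_A\|v\|^2$ for a.e. $x$ and all $v\in\mathbb R^d$; moreover, so that the scheme with numerical integration below makes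 sense, $A$ is Riemann integrable or continuous. Bilinear forms on $L^2_\#(\mathcal Y;\mathbb R^d)$: $a(u,v)=(Au,v)_{L^2_\#}$, $a^{-1}(u,v)=(A^{-1}u,v)_{L^2_\#}$. Trigonometric polynomials: for $\boldsymbol N\in\mathbb N^d$ with all $N_\alpha$ odd, $\mathbb Z^d_{\boldsymbol N}=\{k\in\mathbb Z^d:-N_\alpha/2\le k_\alpha<N_\alpha/2\}$, $\mathcal T^d_{\boldsymbol N}=\{\sum_{k\in\mathbb Z^d_{\boldsymbol N}}c_k\varphi_k:\ c_k=\overline{c_{-k}}\in\mathbb C^d\}$, $\mathcal E_{\boldsymbol N}=\mathcal E\cap\mathcal T^d_{\boldsymbol N}$, $\mathcal J_{\boldsymbol N}=\mathcal J\cap\mathcal T^d_{\boldsymbol N}$. Grid points: $x_{\boldsymbol N}^k=(k_\alpha/N_\alpha)_\alpha$, $k\in\mathbb Z^d_{\boldsymbol N}$. Homogenized matrices are the symmetric matrices in $\mathbb R^{d\times d}$ satisfying, for all $E,J\in\mathbb R^d$: - Continuous: $A_{\mathrm H}E\cdot E=\min_{e\in\mathcal E}a(E+e,E+e)$, $\;B_{\mathrm H}J\cdot J=\min_{j\in\mathcal J}a^{-1}(J+j,J+j)$. - Galerkin approximation (Ga): $A_{\mathrm H,\boldsymbol N}E\cdot E=\inf_{e\in\mathcal E_{\boldsymbol N}}a(E+e,E+e)$, $\;B_{\mathrm H,\boldsymbol N}J\cdot J=\inf_{j\in\mathcal J_{\boldsymbol N}}a^{-1}(J+j,J+j)$. -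 Galerkin approximation with numerical integration (GaNi): with $\widetilde a_{\boldsymbol N}(u,v)=\sum_{k\in\mathbb Z^d_{\boldsymbol N}}A(x^k_{\boldsymbol N})u(x^k_{\boldsymbol N})\cdot v(x^k_{\boldsymbol N})$ and $\widetilde a_{\boldsymbol N}^{-1}(u,v)=\sum_{k\in\mathbb Z^d_{\boldsymbol N}}A^{-1}(x^k_{\boldsymbol N})u(x^k_{\boldsymbol N})\cdot v(x^k_{\boldsymbol N})$ on $\mathcal T^d_{\boldsymbol N}$, let $\widetilde e^{(E)}_{\boldsymbol N}\in\mathcal E_{\boldsymbol N}$ be the minimizer of $e\mapsto\widetilde a_{\boldsymbol N}(E+e,E+e)$ over $\mathcal E_{\boldsymbol N}$ and $\widetilde\jmath^{(J)}_{\boldsymbol N}\in\mathcal J_{\boldsymbol N}$ the minimizer of $j\mapsto\widetilde a^{-1}_{\boldsymbol N}(J+j,J+j)$ over $\mathcal J_{\boldsymbol N}$. Then $\widetilde A^{\mathrm{bound}}_{\mathrm H,\boldsymbol N}E\cdot E=a(E+\widetilde e^{(E)}_{\boldsymbol N},E+\widetilde e^{(E)}_{\boldsymbol N})$, $\;\widetilde B^{\mathrm{bound}}_{\mathrm H,\boldsymbol N}J\cdot J=a^{-1}(J+\widetilde\jmath^{(J)}_{\boldsymbol N},J+\widetilde\jmath^{(J)}_{\boldsymbol N})$. Löwner order: for $L,M\in\mathbb R^{d\times d}_{\mathrm{spd}}$, $L\preceq M$ means $Lu\cdot u\le Mu\cdot u$ for all $u\in\mathbb R^d$. *)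

(* Defs.v *)
From HB Require Import structures.
From mathcomp Require Import all_boot all_order all_algebra.
From mathcomp Require Import all_classical all_reals all_analysis.
From mathcomp Require Import complex.

Set Implicit Arguments.
Unset Strict Implicit.
Unset Printing Implicit Defensive.
Import Order.TTheory GRing.Theory Num.Theory.
Import numFieldNormedType.Exports.

Local Open Scope classical_set_scope.
Local Open Scope ring_scope.

(* Borel sigma-algebra and Lebesgue measure on 'cV[R]_d, transported from
   d.-tuple R, on which the library has the product sigma-algebra. *)

Definition cV_display : measure_display -> measure_display.
Proof. exact. Qed.

Definition col_of_tuple (R : realType) (d : nat)
    (t : d.-tuple (measurableTypeR R)) : 'cV[R]_d := \col_i tnth t i.

Section measurable_cV.
Context (R : realType) (d : nat).

Definition measurable_cV : set (set 'cV[R]_d) :=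
  [set B | measurable (@col_of_tuple R d @^-1` B)].

Let cV_set0 : measurable_cV set0.
Proof. by rewrite /measurable_cV /= preimage_set0. Qed.

Let cV_setC B : measurable_cV B -> measurable_cV (~` B).
Proof. by rewrite /measurable_cV /= preimage_setC; exact: measurableC. Qed.

Let cV_bigcup (F : (set 'cV[R]_d)^nat) :
  (forall i, measurable_cV (F i)) -> measurable_cV (\bigcup_i (F i)).
Proof.
by move=> mF; rewrite /measurable_cV /= preimage_bigcup; exact: bigcupT_measurable.
Qed.

HB.instance Definition _ := @isMeasurable.Build (cV_display default_measure_display)
  'cV[R]_d measurable_cV cV_set0 cV_setC cV_bigcup.

Lemma measurable_col_of_tuple : measurable_fun setT (@col_of_tuple R d).
Proof. by move=> _ B mB; rewrite setTI. Qed.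

End measurable_cV.

Section lebesgue_cV.
Context (R : realType).
Local Notation T := (measurableTypeR R).

Definition tuple_cons (n : nat) (p : n.-tuple T * T) : n.+1.-tuple T :=
  [tuple of p.2 :: p.1].

Lemma measurable_tuple_cons (n : nat) : measurable_fun setT (@tuple_cons n).
Proof. exact: measurable_cons measurable_snd measurable_fst. Qed.

(* The library's measure structure on pushforward takes the measurability of f
   as an argument that unification cannot find. *)
Definition image_measure d1 d2 (T1 : measurableType d1) (T2 : measurableType d2)
    (m : {measure set T1 -> \bar R}) (f : T1 -> T2)
    (mf : measurable_fun setT f) : {measure set T2 -> \bar R} :=
  measure_function_pushforward__canonical__measure_function_Measure m mf.

Fixpoint lebesgue_tuple (n : nat) : {measure set (n.-tuple T) -> \bar R} :=
  match n with
  | 0 => [the measure _ _ of dirac ([tuple] : 0.-tuple T)]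
  | n'.+1 =>
      image_measure
        [the measure _ _ of (lebesgue_tuple n' \x lebesgue_measure)%E]
        (@measurable_tuple_cons n')
  end.

Definition leb (d : nat) : {measure set 'cV[R]_d -> \bar R} :=
  image_measure (lebesgue_tuple d) (@measurable_col_of_tuple R d).

End lebesgue_cV.

Section periodic_functions.
Context (R : realType) (d : nat).
Local Notation Rd := 'cV[R]_d.
Local Notation Zd := 'cV[int]_d.
Local Notation C := R[i].

Definition Y : set Rd := [set x : Rd | forall i, - 2^-1 < x i 0 < 2^-1].

Definition dot (u v : Rd) : R := \sum_i u i 0 * v i 0.

Definition Zperiodic (X : Type) (f : Rd -> X) : Prop :=
  forall (k : Zd) (x : Rd), f (x + map_mx intr k) = f x.

(* Lebesgue measurability on the cell: equality almost everywhere with a Borel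
   function.  It matters for the coefficients, whose point values are used. *)
Definition ae_measurable (f : Rd -> R) : Prop :=
  exists2 g : Rd -> R,
    measurable_fun setT g & {ae leb R d, forall x, Y x -> f x = g x}.

Definition ae_bounded (f : Rd -> R) : Prop :=
  exists M : R, {ae leb R d, forall x, Y x -> `|f x| <= M}.

(* Elements are functions rather than classes; every class has a Borel
   periodic representative. *)
Definition L2per : set (Rd -> Rd) :=
  [set v : Rd -> Rd | Zperiodic v /\ forall i : 'I_d,
     measurable_fun setT (fun x => v x i 0) /\
     (\int[leb R d]_(x in Y) ((v x i 0) ^+ 2)%:E < +oo)%E].

(* exp (2 pi i k.x) *)
Definition phi (k : Zd) (x : Rd) : C :=
  let t := 2 * pi * dot (map_mx intr k) x in (cos t +i* sin t)%C.

Definition integralC (f : Rd -> C) : C :=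
  ((\int[leb R d]_(x in Y) complex.Re (f x))
   +i* (\int[leb R d]_(x in Y) complex.Im (f x)))%C.

Definition fourier (v : Rd -> Rd) (k : Zd) : 'cV[C]_d :=
  \col_i integralC (fun x => (v x i 0)%:C%C * phi (- k) x).

Definition mean (v : Rd -> Rd) : 'cV[C]_d := fourier v 0.

Definition curl_free (v : Rd -> Rd) : Prop :=
  forall (k : Zd) (i j : 'I_d),
    (k j 0)%:~R * fourier v k i 0 - (k i 0)%:~R * fourier v k j 0 = 0.

Definition div_free (v : Rd -> Rd) : Prop :=
  forall k : Zd, \sum_i (k i 0)%:~R * fourier v k i 0 = 0.

Definition spaceE : set (Rd -> Rd) :=
  [set v : Rd -> Rd | [/\ L2per v, mean v = 0 & curl_free v]].

Definition spaceJ : set (Rd -> Rd) :=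
  [set v : Rd -> Rd | [/\ L2per v, mean v = 0 & div_free v]].

Definition indices (N : 'I_d -> nat) : set Zd :=
  [set k : Zd | forall i, - ((N i)%:R / 2) <= (k i 0)%:~R :> rat /\
                     (k i 0)%:~R < (N i)%:R / 2 :> rat].

Definition trig_poly (N : 'I_d -> nat) : set (Rd -> Rd) :=
  [set v : Rd -> Rd | exists2 c : Zd -> 'cV[C]_d,
     forall k, indices N k -> c k = map_mx conjc (c (- k)) &
     forall x, map_mx (fun r : R => r%:C%C) (v x) =
               \sum_(k \in indices N) phi k x *: c k].

Definition spaceEN (N : 'I_d -> nat) := spaceE `&` trig_poly N.
Definition spaceJN (N : 'I_d -> nat) := spaceJ `&` trig_poly N.

Definition grid_point (N : 'I_d -> nat) (k : Zd) : Rd :=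
  \col_i ((k i 0)%:~R / (N i)%:R).

End periodic_functions.

Section riemann.
Context (R : realType) (d : nat).
Local Notation Rd := 'cV[R]_d.

(* Darboux integrability on the closed cell.  A partition is a product of
   partitions - 1/2 :: P i of the edges of the cell. *)

Definition is_partition (P : 'I_d -> seq R) : Prop :=
  forall i, itv_partition (- 2^-1) (2^-1) (P i).

Definition node (P : 'I_d -> seq R) (i : 'I_d) (j : nat) : R :=
  nth 0 (- 2^-1 :: P i) j.

Definition cell (P : 'I_d -> seq R)
    (k : {dffun forall i : 'I_d, 'I_(size (P i))}) : set Rd :=
  [set x : Rd | forall i, node P i (k i) <= x i 0 <= node P i (k i).+1].

Definition cell_volume (P : 'I_d -> seq R)
    (k : {dffun forall i : 'I_d, 'I_(size (P i))}) : R :=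
  \prod_i (node P i (k i).+1 - node P i (k i)).

Definition upper_sum (f : Rd -> R) (P : 'I_d -> seq R) : R :=
  \sum_(k : {dffun forall i : 'I_d, 'I_(size (P i))})
    sup (f @` cell k) * cell_volume k.

Definition lower_sum (f : Rd -> R) (P : 'I_d -> seq R) : R :=
  \sum_(k : {dffun forall i : 'I_d, 'I_(size (P i))})
    inf (f @` cell k) * cell_volume k.

Definition riemann_integrable (f : Rd -> R) : Prop :=
  (exists M : R, forall x : Rd,
     (forall i, - 2^-1 <= x i 0 <= 2^-1) -> `|f x| <= M) /\
  sup (lower_sum f @` [set P | is_partition P]) =
  inf (upper_sum f @` [set P | is_partition P]).

End riemann.

Section homogenization.
Context (R : realType) (d : nat).
Local Notation Rd := 'cV[R]_d.

Definition spd (M : 'M[R]_d) : Prop :=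
  M^T = M /\ forall u : Rd, u != 0 -> 0 < dot (M *m u) u.

(* The order is defined on spd matrices only; both arguments are required to
   be spd. *)
Definition lowner_le (L M : 'M[R]_d) : Prop :=
  [/\ spd L, spd M & forall u : Rd, dot (L *m u) u <= dot (M *m u) u].

Record coefficient_field (A : Rd -> 'M[R]_d) : Prop := {
  coef_periodic : Zperiodic A;
  coef_spd : forall x, Y x -> spd (A x);
  coef_Linfty : forall i j, ae_measurable (fun x => A x i j) /\
                            ae_bounded (fun x => A x i j);
  coef_elliptic : exists c C : R, [/\ 0 < c, c <= C &
    {ae leb R d, forall x, Y x -> forall v : Rd,
       c * dot v v <= dot (A x *m v) v <= C * dot v v}];
  coef_regular :
    (forall i j, riemann_integrable (fun x => A x i j)) \/ continuous A
}.

Definition inv_field (A : Rd -> 'M[R]_d) : Rd -> 'M[R]_d := fun x => invmx (A x).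

Definition bform (A : Rd -> 'M[R]_d) (u v : Rd -> Rd) : R :=
  \int[leb R d]_(x in @Y R d) dot (A x *m u x) (v x).

Definition bformN (N : 'I_d -> nat) (A : Rd -> 'M[R]_d) (u v : Rd -> Rd) : R :=
  \sum_(k \in indices N)
    let x := grid_point R N k in dot (A x *m u x) (v x).

Definition energies (A : Rd -> 'M[R]_d) (V : set (Rd -> Rd)) (E : Rd) : set R :=
  [set bform A (cst E \+ e) (cst E \+ e) | e in V].

Definition is_minimum (S : set R) (m : R) : Prop := S m /\ lbound S m.

Definition is_minimizer (V : set (Rd -> Rd)) (F : (Rd -> Rd) -> R)
    (e : Rd -> Rd) : Prop :=
  V e /\ forall e', V e' -> F e <= F e'.

Definition homogenized (A : Rd -> 'M[R]_d) (V : set (Rd -> Rd))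
    (M : 'M[R]_d) : Prop :=
  M^T = M /\ forall E : Rd, is_minimum (energies A V E) (dot (M *m E) E).

Definition homogenizedGa (A : Rd -> 'M[R]_d) (V : set (Rd -> Rd))
    (M : 'M[R]_d) : Prop :=
  M^T = M /\ forall E : Rd, dot (M *m E) E = inf (energies A V E).

(* The discrete form is positive definite on trigonometric polynomials (N odd),
   so the minimizer e is unique. *)
Definition boundGaNi (N : 'I_d -> nat) (A : Rd -> 'M[R]_d)
    (V : set (Rd -> Rd)) (M : 'M[R]_d) : Prop :=
  M^T = M /\ forall E : Rd, exists2 e : Rd -> Rd,
    is_minimizer V (fun e' => bformN N A (cst E \+ e') (cst E \+ e')) e &
    dot (M *m E) E = bform A (cst E \+ e) (cst E \+ e).

End homogenization.

(* Main.v *)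
From HB Require Import structures.
Require Import Defs.
From mathcomp Require Import all_boot all_order all_algebra.
From mathcomp Require Import all_classical all_reals all_analysis.
From mathcomp Require Import measurable_realfun complex.
From mathcomp Require Import ring lra.

Set Implicit Arguments.
Unset Strict Implicit.
Unset Printing Implicit Defensive.
Import Order.TTheory GRing.Theory Num.Theory.
Import numFieldNormedType.Exports.

Local Open Scope classical_set_scope.
Local Open Scope ring_scope.

(* The upper chain is the inclusion of the trigonometric fields in [spaceE]
   together with the fact that the GaNi minimizer is an admissible competitor;
   the lower chain is the same statement for the inverse coefficients and
   [spaceJ], inverted.  For [invmx BH = AH], let [e] minimize the primal energy
   at [E] and put [s := A (E + e)].  The Euler equation gives [s] the mean
   [AH E] and makes it orthogonal to every gradient wave, so [s - AH E] is in
   [spaceJ].  Since [A^-1 s = E + e] is orthogonal to [spaceJ], [s] is the dual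
   minimizer at [AH E], and the dual Euler equation reads [BH (AH E) = E].

   Orthogonality of [spaceE] and [spaceJ], which are defined by Fourier
   coefficients, needs the density of trigonometric polynomials in L2.  The sets
   whose indicator lies in their L2-closure form a sigma-algebra containing
   [q > 0] for every real trigonometric polynomial [q], as polynomials in [q]
   converge boundedly to this indicator.  On the cell,
   [x_i < a] is such a set, so all Borel sets are. *)

(** * Integration on the periodicity cell *)

(** The coefficients are only almost everywhere equal to Borel functions, so the energy integrands
    need not be measurable. Each form is therefore replaced by that of a Borel periodic field [F]
    which is elliptic at every point. Such fields are stable under inversion, so every variational
    statement is proved once and applied to both [A] and [inv_field A]. Complex exponentials are
    traded for real waves [cos (2 pi k.x + th)]; quantifying over the phase [th] treats sine and
    cosine together. Orthogonality of the two spaces does not expand both fields: one of them is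
    approximated, and the approximant is split wave by wave, where curl and divergence only
    constrain the direction of the amplitude. Since the minima are given for all mean values at
    once, a variation may change the mean together with the fluctuation. This single Euler equation
    yields both the mean of the flux and its orthogonality to the fluctuations. *)

Section ae_integral.
Context d (T : measurableType d) (R : realType).
Context (mu : {measure set T -> \bar R}).

Import HBNNSimple.

(* Neither function need be measurable: the integral is the supremum of the
   integrals of the simple functions below, and these may be cut off on [N]. *)
Lemma ge0_le_integral_off_null (N : set T) (f g : T -> \bar R) :
  measurable N -> mu N = 0%E ->
  (forall x, 0 <= f x)%E -> (forall x, 0 <= g x)%E ->
  (forall x, ~ N x -> (f x <= g x)%E) ->
  (\int[mu]_x f x <= \int[mu]_x g x)%E.
Proof.
move=> mN N0 f0 g0 fg; rewrite !ge0_integralTE//.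
apply: ge_ereal_sup => _ [h /= hf <-].
have [k kE] : exists k : {nnsfun T >-> R}, forall x, k x = h x * \1_(~` N) x.
  by exists (proj_nnsfun h (measurableC mN)).
have -> : sintegral mu h = sintegral mu k.
  rewrite -!integralT_nnsfun; apply: ge0_ae_eq_integral => //.
  - exact/measurable_EFinP.
  - exact/measurable_EFinP.
  - by move=> x _; rewrite lee_fin.
  - by move=> x _; rewrite lee_fin.
  - exists N; split => // x /= /not_implyP[_]; apply: contra_notP => Nx.
    by rewrite kE indicE mem_set//= mulr1.
apply: ereal_sup_ubound; exists k => //= x.
rewrite kE indicE; have [Nx|Nx] := pselect (N x).
  by rewrite memNset ?mulr0//=; exact.
rewrite mem_set//= mulr1; exact: le_trans (hf x) (fg x Nx).
Qed.

(** Serves to compare the form of [A] with that of a Borel field equal to it almost everywhere.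
    Positive and negative parts are bounded by each other in both directions. *)
Lemma ae_eq_Rintegral (D : set T) (f g : T -> R) :
  {ae mu, forall x, D x -> f x = g x} ->
  \int[mu]_(x in D) f x = \int[mu]_(x in D) g x.
Proof.
case=> N [mN N0 subN]; rewrite /Rintegral; congr fine.
have E x : ~ N x -> D x -> f x = g x.
  by move=> Nx; apply: contra_notP Nx => nfg; apply: subN.
rewrite integralE [RHS]integralE.
congr (_ - _)%E; rewrite integral_mkcond [RHS]integral_mkcond.
  by apply/eqP; rewrite eq_le; apply/andP; split;
  apply: (ge0_le_integral_off_null mN N0) => x; rewrite /patch; case: ifPn => //;
    rewrite inE => Dx // Nx; rewrite !funeposE E.
by apply/eqP; rewrite eq_le; apply/andP; split;
  apply: (ge0_le_integral_off_null mN N0) => x; rewrite /patch; case: ifPn => //;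
    rewrite inE => Dx // Nx; rewrite !funenegE E.
Qed.

End ae_integral.

(** * Borel measurability on column vectors *)

Section cV_measurability.
Context (R : realType) (d : nat).

Lemma measurable_coord (i : 'I_d) :
  measurable_fun setT (fun x : 'cV[R]_d => x i 0).
Proof.
move=> _ B mB; rewrite setTI.
rewrite /measurable/= /measurable_cV/=.
have := @measurable_tnth _ (measurableTypeR R) d i measurableT B mB.
rewrite setTI; congr measurable.
by apply/seteqP; split => t /=; rewrite mxE.
Qed.

Lemma measurable_to_cV d' (T : measurableType d') (f : T -> 'cV[R]_d) :
  (forall i, measurable_fun setT (fun x => f x i 0)) -> measurable_fun setT f.
Proof.
move=> mf.
have -> : f = @col_of_tuple R d \o (fun x => [tuple f x i 0 | i < d]).
  by apply/funext => x; apply/colP => i; rewrite /= mxE tnth_mktuple.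
apply: measurableT_comp; first exact: measurable_col_of_tuple.
apply/measurable_fun_tnthP => i.
rewrite (_ : _ \o _ = (fun x => f x i 0)); first exact: mf.
by apply/funext => x/=; rewrite tnth_mktuple.
Qed.

Lemma measurable_Y : measurable (@Y R d).
Proof.
rewrite (_ : @Y R d = \big[setI/setT]_(i < d)
   ((fun x : 'cV[R]_d => x i 0) @^-1` [set` `](- 2^-1), (2^-1)[])).
  apply: bigsetI_measurable => i _.
  rewrite -[X in measurable X]setTI.
  by apply: measurable_coord => //; exact: measurable_itv.
rewrite -bigcap_seq; apply/seteqP; split => x /=.
  by move=> Yx i _ /=; rewrite in_itv/=; exact: Yx.
by move=> Yx i; have := Yx i (mem_index_enum i); rewrite /= in_itv.
Qed.

End cV_measurability.

(** * Lebesgue measure of cubes, and sigma-finiteness *)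

Section lebesgue_tuple_cells.
Context (R : realType).
Local Notation T := (measurableTypeR R).

Definition cube (r : R) (n : nat) : set (n.-tuple T) :=
  [set t | forall i, - r < tnth t i < r].
Arguments cube : clear implicits.

Lemma tuple_cons_cube (r : R) n :
  @tuple_cons R n @^-1` cube r n.+1 = cube r n `*` `](- r), r[%classic.
Proof.
apply/seteqP; split => -[t x]; rewrite /cube /= in_itv/=.
  move=> h; split; last by have := h ord0; rewrite (tnth_nth 0).
  by move=> i; have := h (lift ord0 i); rewrite tnthS.
move=> [h hx] i; case: (unliftP ord0 i) => [j|] ->; last by rewrite (tnth_nth 0).
by rewrite tnthS.
Qed.

Lemma measurable_cube r n : measurable (cube r n).
Proof.
rewrite (_ : cube r n = \big[setI/setT]_(i < n)
   ((fun t : n.-tuple T => tnth t i) @^-1` `](- r), r[%classic)).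
  apply: bigsetI_measurable => i _.
  rewrite -[X in measurable X]setTI.
  by apply: measurable_tnth => //; exact: measurable_itv.
rewrite -bigcap_seq; apply/seteqP; split => x /=.
  by move=> Yx i _ /=; rewrite in_itv/=; exact: Yx.
by move=> Yx i; have := Yx i (mem_index_enum i); rewrite /= in_itv.
Qed.

Lemma lebesgue_tuple_cube (r : R) n : 0 < r ->
  lebesgue_tuple R n (cube r n) = ((2 * r) ^+ n)%:E.
Proof.
move=> r0; elim: n => [|n IH].
  by rewrite /= diracE mem_set// => -[].
rewrite [LHS](_ : _ = (lebesgue_tuple R n \x lebesgue_measure)%E
   (@tuple_cons R n @^-1` cube r n.+1))//.
rewrite tuple_cons_cube product_measure1E//; last exact: measurable_cube.
rewrite IH; transitivity (((2 * r) ^+ n)%:E *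
  lebesgue_measure [set` `](- r)%R, r[%R])%E => //.
rewrite lebesgue_measure_itv/= lte_fin gtrN// -EFinB -EFinM exprSr.
by congr (_ * _)%:E; ring.
Qed.

Lemma sigma_finite_lebesgue_tuple n : sigma_finite setT (lebesgue_tuple R n).
Proof.
exists (fun m => cube m.+1%:R n).
  apply/esym; rewrite -subTset => t _.
  pose M := \sum_i `|tnth t i|.
  exists (Num.truncn M) => // i.
  rewrite -ltr_norml; apply: le_lt_trans (truncnS_gt M).
  by rewrite /M (bigD1 i)//= lerDl sumr_ge0.
move=> m; split; first exact: measurable_cube.
by rewrite lebesgue_tuple_cube// ltry.
Qed.

End lebesgue_tuple_cells.

Arguments cube {R} r n.

(** * Integrals of characters in one variable *)

Section characters.
Context (R : realType).
Local Notation T := (measurableTypeR R).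

Lemma sin_period (x : R) (k : int) : sin (x + pi * k%:~R) = (-1) ^ k * sin x.
Proof.
have N (n : nat) (y : R) : sin (y + pi * n%:R) = (-1) ^+ n * sin y.
  elim: n y => [|n IH] y; first by rewrite mulr0 addr0 expr0 mul1r.
  by rewrite -addn1 natrD mulrDr mulr1 addrA sinDpi IH exprD expr1 mulrN1 mulNr.
case: k => n; first exact: N.
rewrite NegzE mulrNz mulrN.
have := N n.+1 (x - pi * n.+1%:R); rewrite subrK => ->.
rewrite -exprnN -exprVn invrN1 mulrA -exprD addnn -mul2n.
by rewrite exprM sqrrN !expr1n mul1r.
Qed.

(** For [k != 0] the antiderivative takes the same value at both ends of the period. The phase
    covers the sine as well, and it will absorb the remaining coordinates in the induction on the
    dimension. *)
Lemma integral_cos_period (k : int) (th : R) :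
  (\int[lebesgue_measure]_(x in [set` `](- 2^-1)%R, (2^-1)%R[])
     (cos (2 * pi * (k%:~R * x) + th)%R)%:E
   = (if k == 0%R then cos th else 0%R)%:E)%E.
Proof.
have ab : - 2^-1 < 2^-1 :> R by rewrite gtrN// invr_gt0.
case: eqP => [->|/eqP k0].
  under eq_integral do rewrite mul0r mulr0 add0r.
  rewrite integral_cst//= lebesgue_measure_itv/= lte_fin ab -EFinB -EFinM.
  by congr (_%:E); field.
pose w : R := 2 * pi * k%:~R.
have w0 : w != 0 by rewrite /w mulf_neq0 ?intr_eq0// mulf_neq0// gt_eqF// pi_gt0.
pose F (x : R) := w^-1 * sin (w * x + th).
have dF x : is_derive (x : R^o) 1 (F : R^o -> R^o) (cos (w * x + th)).
  (* The shape in which the rules for scaling and composition deliver the derivative. *)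
  have -> : cos (w * x + th) = w^-1 *: (cos (w * x + th) * (w *: 1 + 0)).
    by rewrite /GRing.scale/= mulr1 addr0; field.
  exact: is_deriveZ.
have cont : continuous (fun x : R => cos (w * x + th)).
  move=> x; apply: (@continuous_comp _ _ _ (fun x => w * x + th) cos); last exact: continuous_cos.
  by apply: cvgD; [apply: cvgM; [exact: cvg_cst|exact: cvg_id]|exact: cvg_cst].
rewrite -(@integral_itv_bndoo _ _ _ _ true false)/=; last first.
  apply/measurable_EFinP; apply: measurable_funTS.
  under eq_fun do rewrite mulrA.
  exact: continuous_measurable_fun.
under eq_integral do rewrite !mulrA -/w.
rewrite (@continuous_FTC2 _ _ F) //.
- rewrite -EFinB /F; congr (_%:E).
  rewrite -mulrBr (_ : w * 2^-1 + th = (w * - 2^-1 + th) + pi * (k * 2)%:~R); last first.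
    by rewrite /w intrM; field.
  rewrite sin_period (mulrC k) -exprz_exp -(exprnP (-1) 2) sqrrN expr1n exp1rz.
  by rewrite mul1r subrr mulr0.
- exact: continuous_subspaceT.
- have cF x : {for x, continuous F}.
    by apply: differentiable_continuous; apply/derivable1_diffP; exact: (@ex_derive _ _ _ _ _ _ _ (dF x)).
  split; [by move=> x _|apply: cvg_at_right_filter; exact: cF|apply: cvg_at_left_filter; exact: cF].
- by move=> x _; rewrite derive1E derive_val.
Qed.

End characters.

Section sigma_finite_measure_of.
Context d (T : measurableType d) (R : realType).
Context (mu : {measure set T -> \bar R}).

(** A name for [mu] that carries a proof of sigma-finiteness, so that the structure required by
    Fubini's theorem can be attached to it. *)
Definition sigma_finite_measure_of (mu_sf : sigma_finite setT mu) :
  set T -> \bar R := mu.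

HB.instance Definition _ mu_sf := Measure.on (sigma_finite_measure_of mu_sf).
HB.instance Definition _ mu_sf :=
  Measure_isSigmaFinite.Build _ _ _ (sigma_finite_measure_of mu_sf) mu_sf.

End sigma_finite_measure_of.

(** * Integrals of characters over the unit cube *)

Section tuple_characters.
Context (R : realType).
Local Notation T := (measurableTypeR R).
Local Notation Yt := (cube (2^-1 : R)).

Definition tuple_phase n (k : 'I_n -> int) (t : n.-tuple T) : R :=
  \sum_i (k i)%:~R * tnth t i.

Lemma measurable_tuple_phase n (k : 'I_n -> int) : measurable_fun setT (tuple_phase k).
Proof.
apply: measurable_sum => i; apply: measurable_funM; first exact: measurable_cst.
exact: (@measurable_tnth _ (measurableTypeR R)).
Qed.

Lemma measurable_cos_tuple_phase n (k : 'I_n -> int) (th : R) :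
  measurable_fun setT (fun t => cos (2 * pi * tuple_phase k t + th)).
Proof.
apply: (@measurableT_comp _ _ _ _ _ _ (@cos R)).
  by apply: continuous_measurable_fun; exact: continuous_cos.
apply: measurable_funD; last exact: measurable_cst.
apply: measurable_funM; first exact: measurable_cst.
exact: measurable_tuple_phase.
Qed.

Lemma integrable_cos_tuple_phase n (k : 'I_n -> int) (th : R) :
  (lebesgue_tuple R n).-integrable (Yt n)
    (fun t => (cos (2 * pi * tuple_phase k t + th))%:E).
Proof.
apply: measurable_bounded_integrable.
- exact: measurable_cube.
- by rewrite lebesgue_tuple_cube ?ltry ?invr_gt0.
- by apply: measurable_funTS; exact: measurable_cos_tuple_phase.
- exists 1; split => // x x1 t _ /=; apply: le_trans (ltW x1).
  by rewrite ler_norml cos_geN1 cos_le1.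
Qed.

(** Fubini's theorem, one coordinate at a time: the inner integral runs over the head of the tuple,
    with the phase of the tail added to [th]. It vanishes unless the head frequency is zero, and
    then leaves the same integral over the tail. *)
Lemma integral_cos_tuple_phase n (k : 'I_n -> int) (th : R) :
  (\int[lebesgue_tuple R n]_(t in Yt n) (cos (2 * pi * tuple_phase k t + th)%R)%:E
   = (if [forall i, k i == 0%R] then cos th else 0%R)%:E)%E.
Proof.
elim: n k th => [|n IH] k th.
  rewrite (_ : [forall i, _] = true); last by apply/forallP => -[].
  under eq_integral do rewrite /tuple_phase big_ord0 mulr0 add0r.
  rewrite integral_cst//=; last exact: measurable_cube.
  by rewrite diracE mem_set ?mule1// => -[].
pose m1 : {sigma_finite_measure set (n.-tuple T) -> \bar R} :=
  sigma_finite_measure_of (@sigma_finite_lebesgue_tuple R n).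
pose f (t : n.+1.-tuple T) := (cos (2 * pi * tuple_phase k t + th))%:E.
have intf := integrable_cos_tuple_phase k th.
have mf : measurable_fun setT f.
  by apply/measurable_EFinP; exact: measurable_cos_tuple_phase.
have pre := @tuple_cons_cube R 2^-1 n.
have mpre : measurable (@tuple_cons R n @^-1` Yt n.+1).
  rewrite -[X in measurable X]setTI; apply: measurable_tuple_cons => //.
  exact: measurable_cube.
have intp : (m1 \x lebesgue_measure)%E.-integrable (@tuple_cons R n @^-1` Yt n.+1)
    (f \o @tuple_cons R n).
  apply: measurable_bounded_integrable => //.
  - have := @lebesgue_tuple_cube R 2^-1 n.+1; rewrite invr_gt0 => /(_ (ltr0n _ 2)) E.
    by rewrite [X in (X < _)%E]E ltry.
  - apply: measurable_funTS; apply: measurableT_comp (measurable_cos_tuple_phase _ _) _.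
    exact: measurable_tuple_cons.
  - exists 1; split => // x x1 t _ /=; apply: le_trans (ltW x1).
    by rewrite ler_norml cos_geN1 cos_le1.
transitivity (\int[pushforward (m1 \x lebesgue_measure)%E (@tuple_cons R n)]_(t in Yt n.+1) f t)%E => //.
rewrite (integral_pushforward (@measurable_tuple_cons R n) mf intp); last exact: measurable_cube.
rewrite integral_mkcond -integral12_prod_meas1; last by rewrite -integrable_mkcond.
transitivity (\int[m1]_(x in Yt n) (if k ord0 == 0%R then
   cos (2 * pi * tuple_phase (fun i => k (lift ord0 i)) x + th)%R else 0%R)%:E)%E.
  rewrite [RHS]integral_mkcond; apply: eq_integral => x _.
  rewrite /fubini_F {2}/patch; case: ifPn => xY; last first.
    apply: integral0_eq => y _; rewrite pre /patch memNset// => -[/= xY' _].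
    by move: xY; rewrite mem_set.
  have -> : cos (2 * pi * tuple_phase (fun i => k (lift ord0 i)) x + th) =
     cos (2 * pi * ((0:R) * 0) + (2 * pi * tuple_phase (fun i => k (lift ord0 i)) x + th)).
    by rewrite mul0r mulr0 add0r.
  rewrite mul0r mulr0 add0r -integral_cos_period [RHS]integral_mkcond.
  apply: eq_integral => y _; rewrite /patch pre in_setX xY /=; case: ifPn => // _.
  rewrite /f /tuple_phase big_ord_recl; congr (cos _)%:E.
  rewrite mulrDr -addrA; congr (_ + (_ * _ + _)).
  by apply: eq_bigr => i _; rewrite tnthS.
have -> : [forall i, k i == 0] = (k ord0 == 0) && [forall i, k (lift ord0 i) == 0].
  apply/forallP/andP => [h|[k0 /forallP h] i]; first by split => //; apply/forallP.
  by case: (unliftP ord0 i) => [j|] ->.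
case: eqP => _; last by rewrite integral0_eq.
exact: IH.
Qed.

End tuple_characters.

(** * Real waves on the periodicity cell *)

Section waves.
Context (R : realType) (d : nat).
Local Notation Rd := 'cV[R]_d.
Local Notation Zd := 'cV[int]_d.
Local Notation Y := (@Y R d).
Local Notation mu := (leb R d).

(** The phases [0] and [pi / 2] give the real and imaginary parts of [phi (- k)], the character that
    [fourier] integrates against. *)
Definition wave (k : Zd) (th : R) (x : Rd) : R :=
  cos (2 * pi * dot (map_mx intr k) x + th).

Lemma waveN k th x : wave (- k) th x = wave k (- th) x.
Proof.
rewrite /wave -[RHS]cosN opprD opprK; congr (cos (_ + _)).
rewrite -mulrN; congr (_ * _); rewrite /dot -sumrN; apply: eq_bigr => i _.
by rewrite !mxE rmorphN mulNr.
Qed.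

Lemma wave0 th x : wave 0 th x = cos th.
Proof.
rewrite /wave (_ : dot _ _ = 0) ?mulr0 ?add0r//.
by rewrite /dot big1// => i _; rewrite !mxE mul0r.
Qed.

Lemma wave_phase k th x :
  wave k th x = cos th * wave k 0 x + sin th * wave k (pi / 2) x.
Proof.
by rewrite /wave addr0 cosD cosDpihalf; ring.
Qed.

(** The product-to-sum formula yields both the orthogonality relations and the closure of
    trigonometric polynomials under products. *)
Lemma waveM k l th th' x : wave k th x * wave l th' x =
  2^-1 * wave (k + l) (th + th') x + 2^-1 * wave (k - l) (th - th') x.
Proof.
pose a := 2 * pi * dot (map_mx intr k) x + th.
pose b := 2 * pi * dot (map_mx intr l) x + th'.
have -> : wave (k + l) (th + th') x = cos (a + b).
  rewrite /wave; congr cos; rewrite addrACA -mulrDr; congr (_ * _ + _).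
  by rewrite /dot -big_split; apply: eq_bigr => i _; rewrite !mxE rmorphD/= mulrDl.
have -> : wave (k - l) (th - th') x = cos (a - b).
  rewrite /wave; congr cos; rewrite opprD addrACA -mulrBr; congr (_ * _ + _).
  rewrite /dot -sumrB; apply: eq_bigr => i _.
  by rewrite !mxE rmorphB/= mulrBl.
by rewrite cosB cosD -/a -/b /wave -/a -/b; field.
Qed.

Lemma wave_le1 k th x : `|wave k th x| <= 1.
Proof. by rewrite ler_norml cos_geN1 cos_le1. Qed.

Lemma wave_Zperiodic k th : Zperiodic (wave k th).
Proof.
move=> m x; rewrite /wave.
have -> : dot (map_mx intr k) (x + map_mx intr m) =
    dot (map_mx intr k) x + (\sum_i k i 0 * m i 0)%:~R :> R.
  rewrite /dot rmorph_sum/= -big_split/=; apply: eq_bigr => i _.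
  by rewrite !mxE mulrDr intrM.
set n : int := \sum_i _.
rewrite mulrDr -addrA [_ + th]addrC addrA.
rewrite (_ : 2 * pi * n%:~R = pi * (2 * n)%:~R); last by rewrite intrM; ring.
by rewrite -!sinDpihalf [_ + pi / 2]addrAC sin_period -exprz_exp -(exprnP (-1) 2) sqrrN expr1n exp1rz mul1r.
Qed.

Lemma measurable_wave k th : measurable_fun setT (wave k th).
Proof.
apply: (@measurableT_comp _ _ _ _ _ _ (@cos R)).
  by apply: continuous_measurable_fun; exact: continuous_cos.
apply: measurable_funD; last exact: measurable_cst.
apply: measurable_funM; first exact: measurable_cst.
apply: measurable_sum => i; apply: measurable_funM; last exact: measurable_coord.
exact: measurable_cst.
Qed.

Lemma preimage_Y : @col_of_tuple R d @^-1` Y = cube 2^-1 d.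
Proof.
by apply/seteqP; split => t h i; have := h i; rewrite mxE.
Qed.

Lemma leb_Y : mu Y = 1%E.
Proof.
rewrite [LHS](_ : _ = lebesgue_tuple R d (@col_of_tuple R d @^-1` Y))//.
by rewrite preimage_Y lebesgue_tuple_cube ?invr_gt0// divff// expr1n.
Qed.

Lemma integral_wave k th :
  \int[mu]_(x in Y) wave k th x = if k == 0 then cos th else 0.
Proof.
rewrite /Rintegral.
have E t : wave k th (@col_of_tuple R d t) = cos (2 * pi * tuple_phase (fun i => k i 0) t + th).
  by rewrite /wave; congr (cos (_ * _ + _)); apply: eq_bigr => i _; rewrite !mxE.
have iw := integrable_cos_tuple_phase (fun i => k i 0) th.
rewrite (@integral_pushforward _ _ _ _ _ _ (@measurable_col_of_tuple R d)
  (lebesgue_tuple R d) Y (fun x => (wave k th x)%:E)); last first.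
- exact: measurable_Y.
- by rewrite preimage_Y; apply: eq_integrable iw => [|t _]; [exact: measurable_cube|rewrite /= E].
- by apply/measurable_EFinP; exact: measurable_wave.
under eq_integral do rewrite /= E.
rewrite preimage_Y integral_cos_tuple_phase.
have -> : [forall i, k i 0 == 0] = (k == 0).
  apply/forallP/eqP => [h|-> i]; last by rewrite mxE.
  by apply/colP => i; rewrite mxE; exact/eqP.
by case: eqP.
Qed.

End waves.

Lemma sqr_le_of_norm (R : realDomainType) (a M : R) : `|a| <= M -> a ^+ 2 <= M ^+ 2.
Proof. by rewrite ler_norml => /andP[? ?]; nra. Qed.

(** * Square-integrable scalar functions on the cell *)

Section L2_scalar.
Context (R : realType) (d : nat).
Local Notation Rd := 'cV[R]_d.
Local Notation Y := (@Y R d).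
Local Notation mu := (leb R d).

Definition integrableY (f : Rd -> R) : Prop := mu.-integrable Y (EFin \o f).

(** As in [L2per], measurability is on the whole space and integrability on the cell. No periodicity
    is imposed, so that indicators of arbitrary Borel sets qualify. *)
Definition L2 (f : Rd -> R) : Prop :=
  measurable_fun setT f /\ integrableY (fun x => f x ^+ 2).

Local Notation I f := (\int[mu]_(x in Y) f x).

Lemma integrableY_bounded (f : Rd -> R) M : measurable_fun setT f ->
  (forall x, `|f x| <= M) -> integrableY f.
Proof.
move=> mf fM; apply: measurable_bounded_integrable.
- exact: measurable_Y.
- by rewrite leb_Y ltry.
- exact: measurable_funTS.
- by exists M; split; [exact: num_real|move=> x Mx t _ /=; exact: le_trans (fM t) (ltW Mx)].
Qed.

Lemma integrableYD (f g : Rd -> R) : integrableY f -> integrableY g -> integrableY (fun x => f x + g x).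
Proof. by move=> hf hg; apply: integrableD hf hg; exact: measurable_Y. Qed.

Lemma integrableYZ c (f : Rd -> R) : integrableY f -> integrableY (fun x => c * f x).
Proof. by move=> hf; apply: integrableZl hf; exact: measurable_Y. Qed.

Lemma integralYZ c (f : Rd -> R) : integrableY f -> I (fun x => c * f x) = c * I f.
Proof. by move=> hf; apply: RintegralZl hf; exact: measurable_Y. Qed.

Lemma integralYD (f g : Rd -> R) : integrableY f -> integrableY g ->
  I (fun x => f x + g x) = I f + I g.
Proof. by move=> hf hg; apply: RintegralD hf hg; exact: measurable_Y. Qed.

Lemma le_integralY (f g : Rd -> R) : integrableY f -> integrableY g -> (forall x, Y x -> f x <= g x) ->
  I f <= I g.
Proof. by move=> hf hg fg; apply: le_Rintegral hf hg fg; exact: measurable_Y. Qed.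

Lemma integralY_cst c : I (fun=> c) = c.
Proof. by rewrite Rintegral_cst ?leb_Y ?mulr1//; exact: measurable_Y. Qed.

Lemma le_integrableY (f g : Rd -> R) : measurable_fun setT f -> integrableY g ->
  (forall x, `|f x| <= g x) -> integrableY f.
Proof.
move=> mf hg fg; apply: le_integrable hg.
- exact: measurable_Y.
- by apply/measurable_EFinP; exact: measurable_funTS.
- by move=> x _ /=; rewrite lee_fin (le_trans (fg x))// ler_norm.
Qed.

Lemma integrableY_mul (f g : Rd -> R) : L2 f -> L2 g -> integrableY (fun x => f x * g x).
Proof.
move=> [mf hf] [mg hg].
apply: (le_integrableY (g := fun x => f x ^+ 2 + g x ^+ 2)).
- exact: measurable_funM.
- exact: integrableYD.
- by move=> x; rewrite ler_norml; apply/andP; split; nra.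
Qed.

Lemma L2D (f g : Rd -> R) : L2 f -> L2 g -> L2 (fun x => f x + g x).
Proof.
move=> Lf Lg; have := integrableY_mul Lf Lg; move: Lf Lg => [mf hf] [mg hg] hfg.
split; first exact: measurable_funD.
have := integrableYD (integrableYD hf (integrableYZ 2 hfg)) hg.
by congr integrableY; apply/funext => x; ring.
Qed.

Lemma L2M_bounded (f g : Rd -> R) M : measurable_fun setT f ->
  (forall x, `|f x| <= M) -> L2 g -> L2 (fun x => f x * g x).
Proof.
move=> mf fM [mg hg]; split; first exact: measurable_funM.
apply: (le_integrableY (g := fun x => M ^+ 2 * g x ^+ 2)).
- by apply: measurable_funX; exact: measurable_funM.
- exact: integrableYZ.
- move=> x; rewrite ger0_norm ?sqr_ge0// exprMn ler_wpM2r ?sqr_ge0//.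
  exact: sqr_le_of_norm.
Qed.

Lemma L2_bounded (f : Rd -> R) M : measurable_fun setT f ->
  (forall x, `|f x| <= M) -> L2 f.
Proof.
move=> mf fM; split => //; apply: (@integrableY_bounded _ (M ^+ 2)).
  exact: measurable_funX.
by move=> x; rewrite ger0_norm ?sqr_ge0//; exact: sqr_le_of_norm.
Qed.

Lemma L2Z c (f : Rd -> R) : L2 f -> L2 (fun x => c * f x).
Proof. by apply: (@L2M_bounded (fun=> c) f `|c|) => //; exact: measurable_cst. Qed.

Lemma L2B (f g : Rd -> R) : L2 f -> L2 g -> L2 (fun x => f x - g x).
Proof.
move=> hf hg; have := L2D hf (L2Z (-1) hg).
by congr L2; apply/funext => x; rewrite mulN1r.
Qed.

Lemma L2_cst c : L2 (fun=> c).
Proof. by apply: (@L2_bounded _ `|c|) => //; exact: measurable_cst. Qed.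

Lemma L2_wave k th : L2 (wave k th).
Proof. by apply: (@L2_bounded _ 1); [exact: measurable_wave|move=> x; exact: wave_le1]. Qed.

Lemma integral_waveM k l th th' : I (fun x => wave k th x * wave l th' x) =
  2^-1 * (if k + l == 0 then cos (th + th') else 0) +
  2^-1 * (if k == l then cos (th - th') else 0).
Proof.
have iw m t : integrableY (wave m t).
  by apply: (@integrableY_bounded _ 1); [exact: measurable_wave|move=> x; exact: wave_le1].
under eq_Rintegral do rewrite waveM.
rewrite integralYD; [|exact: integrableYZ|exact: integrableYZ].
by rewrite !integralYZ// !integral_wave subr_eq0.
Qed.

End L2_scalar.

(** * Density of trigonometric polynomials *)

Section step_polynomials.
Context (R : realType).

Lemma bernoulli_ineq (a : R) n : -1 <= a -> 1 + n%:R * a <= (1 + a) ^+ n.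
Proof.
move=> a1; elim: n => [|n IH]; first by rewrite mul0r addr0.
have n0 : 0 <= n%:R :> R by [].
have a10 : 0 <= 1 + a by lra.
rewrite exprSr; apply: le_trans (ler_wpM2r a10 IH).
by rewrite -natr1; nra.
Qed.

(** Half of the decay pays for the factor [n]: with [z = sqrt y], Bernoulli's inequality for [z^-1]
    bounds [n * z ^ n], and the other factor [z ^ n] tends to 0. *)
Lemma cvg_natmul_expr (y : R) : 0 <= y < 1 ->
  (fun n => n%:R * y ^+ n) @ \oo --> (0 : R).
Proof.
move=> /andP[y0 y1].
have [->|yn0] := eqVneq y 0.
  apply: cvg_near_cst; near=> n.
  rewrite expr0n (_ : n == 0%N = false) ?mulr0//; apply/negbTE; near: n.
  by exists 1%N => // n; case: n.
have yp : 0 < y by rewrite lt_neqAle eq_sym yn0.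
pose z := Num.sqrt y.
have z0 : 0 < z by rewrite sqrtr_gt0.
have zz : z * z = y by rewrite -expr2 sqr_sqrtr.
have z1 : z < 1 by rewrite ltNge; apply/negP => z1; nra.
have zi : 0 < z^-1 - 1 by rewrite subr_gt0 invf_gt1.
have bd n : n%:R * y ^+ n <= (z^-1 - 1)^-1 * z ^+ n.
  rewrite -zz exprMn mulrA ler_pM2r ?exprn_gt0//.
  rewrite -[leRHS]mul1r ler_pdivlMr//.
  have B : n%:R * (z^-1 - 1) <= z^-1 ^+ n.
    have zN1 : -1 <= z^-1 - 1 by lra.
    have := bernoulli_ineq n zN1; rewrite (_ : 1 + (z^-1 - 1) = z^-1); last by ring.
    by apply: le_trans; rewrite lerDr.
  have zn : 0 < z ^+ n by rewrite exprn_gt0.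
  rewrite mulrAC -[leRHS](mulVf (lt0r_neq0 zn)) ler_pM2r// -exprVn//.
apply: (@squeeze_cvgr _ _ _ _ (cst 0) (fun n => (z^-1 - 1)^-1 * z ^+ n)).
- by near=> n; rewrite mulr_ge0 ?exprn_ge0//= bd.
- exact: cvg_cst.
- rewrite -[X in _ --> X](mulr0 (z^-1 - 1)^-1); apply: cvgMr.
  by apply: cvg_expr; rewrite ger0_norm ?ltW.
Unshelve. all: by end_near. Qed.

(* The exponent makes the limit at the jump [u = 1/2] exactly 0. *)
Definition step_poly (n : nat) (u : R) : R := (1 - u ^+ n) ^+ (n * 2 ^ n).

Lemma step_poly_itv n (u : R) : 0 <= u <= 1 -> 0 <= step_poly n u <= 1.
Proof.
move=> /andP[u0 u1].
have un0 : 0 <= u ^+ n by rewrite exprn_ge0.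
have un1 : u ^+ n <= 1 by rewrite exprn_ile1.
by rewrite /step_poly exprn_ge0 ?exprn_ile1//; lra.
Qed.

(** Bernoulli's inequality on both sides. Below [1/2] it gives the lower bound [1 - n (2 u)^n]. From
    [1/2] on, [(1 + u^n)^(2^n)] is at least [2], while its product with [(1 - u^n)^(2^n)] is at most
    [1]; hence the latter is at most [1/2], and its [n]-th power at most [2^-n]. *)
Lemma cvg_step_poly (u : R) : 0 <= u <= 1 ->
  (fun n => step_poly n u) @ \oo --> (if u < 2^-1 then 1 else 0 : R).
Proof.
move=> u01; have /andP[u0 u1] := u01; case: ifPn => u2.
  apply: (@squeeze_cvgr _ _ _ _ (fun n => 1 - n%:R * (2 * u) ^+ n) (cst 1)).
  - near=> n; apply/andP; split; last by have /andP[] := step_poly_itv n u01.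
    have := @bernoulli_ineq (- u ^+ n) (n * 2 ^ n).
    rewrite lerN2 exprn_ile1// => /(_ isT).
    by rewrite mulrN natrM natrX exprMn mulrA.
  - rewrite -[X in _ --> X]subr0; apply: cvgB; first exact: cvg_cst.
    by apply: cvg_natmul_expr; apply/andP; split; lra.
  - exact: cvg_cst.
rewrite -leNgt in u2.
apply: (@squeeze_cvgr _ _ _ _ (cst 0) (fun n => 2^-1 ^+ n)).
- near=> n; apply/andP; split; first by have /andP[] := step_poly_itv n u01.
  rewrite /step_poly mulnC exprM.
  have un : 2^-1 ^+ n <= u ^+ n by apply: lerXn2r; rewrite ?nnegrE ?invr_ge0.
  have un1 : u ^+ n <= 1 by rewrite exprn_ile1.
  have un0 : 0 <= u ^+ n by rewrite exprn_ge0.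
  apply: lerXn2r; rewrite ?nnegrE ?exprn_ge0 ?invr_ge0//; first lra.
  have B : 2 <= (1 + u ^+ n) ^+ (2 ^ n).
    apply: le_trans (bernoulli_ineq _ _); last lra.
    rewrite natrX -lerBlDl (_ : 2 - 1 = 2 ^+ n * 2^-1 ^+ n).
      by rewrite ler_pM2l// exprn_gt0.
    by rewrite -exprMn divff// expr1n; ring.
  have C : (1 - u ^+ n) ^+ (2 ^ n) * (1 + u ^+ n) ^+ (2 ^ n) <= 1.
    by rewrite -exprMn exprn_ile1//; nra.
  have D : 0 <= (1 - u ^+ n) ^+ (2 ^ n) by rewrite exprn_ge0//; lra.
  nra.
- exact: cvg_cst.
- by apply: cvg_expr; rewrite ger0_norm ?invr_ge0// invf_lt1// ltr1n.
Unshelve. all: by end_near. Qed.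

End step_polynomials.

(** * The L2-closure of the trigonometric polynomials *)

Section density.
Context (R : realType) (d : nat).
Local Notation Rd := 'cV[R]_d.
Local Notation Y := (@Y R d).
Local Notation mu := (leb R d).
Local Notation I f := (\int[mu]_(x in Y) f x).

(** An inductive predicate instead of a finite sum over frequencies: the properties below follow by
    induction without reindexing. Constants are multiples of the wave of frequency zero. *)
Inductive real_trig : (Rd -> R) -> Prop :=
| real_trig_wave k th : real_trig (wave k th)
| real_trigD f g : real_trig f -> real_trig g -> real_trig (fun x => f x + g x)
| real_trigZ c f : real_trig f -> real_trig (fun x => c * f x).

Lemma real_trig_cst c : real_trig (fun=> c).
Proof.
rewrite (_ : (fun=> c) = (fun x => c * wave 0 0 x)); last first.
  by apply/funext => x; rewrite wave0 cos0 mulr1.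
exact/real_trigZ/real_trig_wave.
Qed.

Lemma real_trigM f g : real_trig f -> real_trig g -> real_trig (fun x => f x * g x).
Proof.
move=> + tg; elim=> [k th|f1 f2 _ h1 _ h2|c f' _ h].
- elim: tg => [l th'|g1 g2 _ h1 _ h2|c g' _ h].
  + rewrite (funext (waveM k l th th')).
    by apply: real_trigD; apply: real_trigZ; exact: real_trig_wave.
  + rewrite (_ : (fun x => _) = (fun x => wave k th x * g1 x + wave k th x * g2 x)).
      exact: real_trigD.
    by apply/funext => x; rewrite mulrDr.
  + rewrite (_ : (fun x => _) = (fun x => c * (wave k th x * g' x))).
      exact: real_trigZ.
    by apply/funext => x; rewrite mulrCA.
- rewrite (_ : (fun x => _) = (fun x => f1 x * g x + f2 x * g x)).
    exact: real_trigD.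
  by apply/funext => x; rewrite mulrDl.
- rewrite (_ : (fun x => _) = (fun x => c * (f' x * g x))).
    exact: real_trigZ.
  by apply/funext => x; rewrite mulrA.
Qed.

Lemma real_trigX f n : real_trig f -> real_trig (fun x => f x ^+ n).
Proof.
move=> tf; elim: n => [|n IH]; first exact: real_trig_cst.
by under eq_fun do rewrite exprS; exact: real_trigM.
Qed.

Lemma measurable_real_trig f : real_trig f -> measurable_fun setT f.
Proof.
elim=> [k th|f1 f2 _ h1 _ h2|c f' _ h]; first exact: measurable_wave.
  exact: measurable_funD.
by apply: measurable_funM => //; exact: measurable_cst.
Qed.

Lemma real_trig_bounded f : real_trig f -> exists2 M, 0 < M & forall x, `|f x| <= M.
Proof.
elim=> [k th|f1 f2 _ [M1 M10 h1] _ [M2 M20 h2]|c f' _ [M M0 h]].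
- by exists 1 => // x; exact: wave_le1.
- exists (M1 + M2); first exact: addr_gt0.
  by move=> x; rewrite (le_trans (ler_normD _ _))// lerD.
- exists (`|c| * M + 1) => [|x]; first by rewrite ltr_wpDl// mulr_ge0// ltW.
  by rewrite normrM (le_trans (ler_wpM2l _ (h x)))// lerDl.
Qed.

Lemma L2_real_trig f : real_trig f -> L2 f.
Proof.
move=> tf; have [M _ fM] := real_trig_bounded tf.
exact: L2_bounded (measurable_real_trig tf) fM.
Qed.

Definition adherent (f : Rd -> R) : Prop :=
  L2 f /\ forall e, 0 < e ->
    exists2 p, real_trig p & I (fun x => (f x - p x) ^+ 2) < e.

Lemma adherent_trig p : real_trig p -> adherent p.
Proof.
move=> tp; split; first exact: L2_real_trig.
move=> e e0; exists p => //; rewrite (_ : (fun x => _) = (fun=> 0)) ?integralY_cst//.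
by apply/funext => x; rewrite subrr expr0n.
Qed.

(** Plays the part of the triangle inequality for squared distances; its factors 2 explain the
    tolerances [e / 4] below. *)
Lemma integral_sqrD_le (f g : Rd -> R) : L2 f -> L2 g ->
  I (fun x => (f x + g x) ^+ 2) <= 2 * I (fun x => f x ^+ 2) + 2 * I (fun x => g x ^+ 2).
Proof.
move=> Lf Lg; have [_ LDf] := L2D Lf Lg; case: Lf => _ Lf; case: Lg => _ Lg.
rewrite -!integralYZ// -integralYD; [|exact: integrableYZ|exact: integrableYZ].
apply: le_integralY => //; first by apply: integrableYD; exact: integrableYZ.
by move=> x _; have := sqr_ge0 (f x - g x); nra.
Qed.

Lemma adherent_closed f : L2 f ->
  (forall e, 0 < e -> exists2 g, adherent g & I (fun x => (f x - g x) ^+ 2) < e) ->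
  adherent f.
Proof.
move=> Lf h; split => // e e0.
have e4 : 0 < e / 4 by rewrite divr_gt0.
have [g [Lg ag] fg] := h _ e4; have [p tp gp] := ag _ e4.
exists p => //.
rewrite (_ : (fun x => _) = (fun x => ((f x - g x) + (g x - p x)) ^+ 2)); last first.
  by apply/funext => x; rewrite addrA subrK.
have := integral_sqrD_le (L2B Lf Lg) (L2B Lg (L2_real_trig tp)); lra.
Qed.

Lemma adherent_eqY f g : L2 g -> {in Y, f =1 g} -> adherent f -> adherent g.
Proof.
move=> Lg fg af; apply: adherent_closed => // e e0; exists f => //.
rewrite (@eq_Rintegral _ _ _ _ _ (fun=> 0)) ?integralY_cst// => x Yx.
by rewrite fg// subrr expr0n.
Qed.

Lemma adherentD f g : adherent f -> adherent g -> adherent (fun x => f x + g x).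
Proof.
move=> [Lf af] [Lg ag]; split; first exact: L2D.
move=> e e0; have e4 : 0 < e / 4 by rewrite divr_gt0.
have [p tp fp] := af _ e4; have [q tq gq] := ag _ e4.
exists (fun x => p x + q x); first exact: real_trigD.
rewrite (_ : (fun x => _) = (fun x => ((f x - p x) + (g x - q x)) ^+ 2)); last first.
  by apply/funext => x; congr (_ ^+ 2); ring.
have := integral_sqrD_le (L2B Lf (L2_real_trig tp)) (L2B Lg (L2_real_trig tq)); lra.
Qed.

(** From [f g - p q = f (g - q) + q (f - p)]: the polynomial [q] is chosen first, since its supremum
    bound [K] decides how close [p] must be to [f]. *)
Lemma adherentM f g M : adherent f -> (forall x, `|f x| <= M) -> adherent g ->
  adherent (fun x => f x * g x).
Proof.
move=> [Lf af] fM [Lg ag]; split; first by case: Lf => mf _; exact: L2M_bounded fM Lg.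
move=> e e0.
(* Each of the two terms of [integral_sqrD_le] is to be below [e / 4]; the [+ 1] keeps the
   denominator positive when [M] is zero. *)
have a0 : 0 < e / (8 * (M ^+ 2 + 1)) by rewrite divr_gt0// mulr_gt0// ltr_wpDl ?sqr_ge0.
have [q tq gq] := ag _ a0; have [K K0 qK] := real_trig_bounded tq.
have b0 : 0 < e / (8 * (K ^+ 2 + 1)) by rewrite divr_gt0// mulr_gt0// ltr_wpDl ?sqr_ge0.
have [p tp fp] := af _ b0.
exists (fun x => p x * q x); first exact: real_trigM.
rewrite (_ : (fun x => _) = (fun x => (f x * (g x - q x) + q x * (f x - p x)) ^+ 2)); last first.
  by apply/funext => x; congr (_ ^+ 2); ring.
have Lgq := L2B Lg (L2_real_trig tq); have Lfp := L2B Lf (L2_real_trig tp).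
have [mf _] := Lf; have mq := measurable_real_trig tq.
have L1 := L2M_bounded mf fM Lgq; have L2' := L2M_bounded mq qK Lfp.
have B (h k : Rd -> R) (N : R) : (forall x, `|h x| <= N) -> measurable_fun setT h -> L2 k ->
    I (fun x => (h x * k x) ^+ 2) <= N ^+ 2 * I (fun x => k x ^+ 2).
  move=> hN mh Lk; have [_ i1] := L2M_bounded mh hN Lk; case: Lk => _ i2.
  rewrite -integralYZ//; apply: le_integralY => //; first exact: integrableYZ.
  by move=> x _; rewrite exprMn ler_wpM2r ?sqr_ge0//; exact: sqr_le_of_norm.
have S (N t : R) : 0 <= t -> t < e / (8 * (N ^+ 2 + 1)) -> 2 * (N ^+ 2 * t) < e / 4.
  move=> t0; have N0 := sqr_ge0 N; rewrite ltr_pdivlMr; last by rewrite mulr_gt0// ltr_wpDl.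
  by nra.
have I0 (h : Rd -> R) : 0 <= I (fun x => h x ^+ 2).
  by apply: Rintegral_ge0 => x _; exact: sqr_ge0.
have S1 := S M _ (I0 _) gq; have S2 := S K _ (I0 _) fp.
have := integral_sqrD_le L1 L2'; have := B _ _ _ fM mf Lgq; have := B _ _ _ qK mq Lfp.
lra.
Qed.

(** Dominated convergence applied to the squared errors, with [h ^+ 2] as dominating function. *)
Lemma adherent_cvg (f : Rd -> R) (g : nat -> Rd -> R) (h : Rd -> R) :
  L2 f -> L2 h -> (forall n, adherent (g n)) ->
  (forall x, Y x -> g ^~ x @ \oo --> f x) ->
  (forall n x, Y x -> `|f x - g n x| <= h x) -> adherent f.
Proof.
move=> Lf [mh ih] ag gf fgh; apply: adherent_closed => // e e0.
have mY := @measurable_Y R d.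
pose q n x := ((f x - g n x) ^+ 2)%:E.
have mq n : measurable_fun Y (q n).
  apply/measurable_EFinP; apply: measurable_funTS.
  by have [mfg _] := L2B Lf (ag n).1; exact: measurable_funX.
have cq : {ae mu, forall x, Y x -> q ^~ x @ \oo --> 0%E}.
  apply: aeW => x Yx; apply/cvg_EFin; first by near=> n.
  rewrite [X in _ --> X](_ : _ = (f x - f x) ^+ 2); last by rewrite subrr expr0n.
  rewrite (_ : _ \o _ = (fun n => (f x - g n x) * (f x - g n x)))// expr2.
  by apply: cvgM; (apply: cvgB; [exact: cvg_cst|exact: gf]).
have bq : {ae mu, forall x n, Y x -> (`|q n x| <= (h x ^+ 2)%:E)%E}.
  apply: aeW => x n Yx; rewrite lee_fin ger0_norm ?sqr_ge0//.
  by apply: sqr_le_of_norm; exact: fgh.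
have [_ _] := dominated_convergence mY mq (measurable_cst 0%E) cq ih bq.
rewrite integral0 => /fine_cvgP[_ /cvgrPdist_lt /(_ e e0)[n _ /(_ n (leqnn n))]].
rewrite /= sub0r normrN => H; exists (g n) => //; apply: le_lt_trans H; exact: ler_norm.
Unshelve. all: by end_near. Qed.

End density.

(** * Sets whose indicator lies in the closure *)

Section density_indicators.
Context (R : realType) (d : nat).
Local Notation Rd := 'cV[R]_d.
Local Notation Y := (@Y R d).
Local Notation mu := (leb R d).
Local Notation I f := (\int[mu]_(x in Y) f x).
Local Notation adherent := (@adherent R d).

Definition adherent_set (A : set Rd) : Prop :=
  measurable A /\ adherent (\1_A : Rd -> R).

Lemma indic_norm_le1 (A : set Rd) x : `|\1_A x : R| <= 1.
Proof. by rewrite indicE; case: (x \in A); rewrite ?normr1 ?normr0. Qed.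

Lemma L2_indic (A : set Rd) : measurable A -> L2 (\1_A : Rd -> R).
Proof.
move=> mA; apply: (@L2_bounded _ _ _ 1); last exact: indic_norm_le1.
exact: measurable_indic.
Qed.

Lemma adherent_setC A : adherent_set A -> adherent_set (~` A).
Proof.
move=> [mA aA]; split; first exact: measurableC.
have -> : \1_(~` A) = (fun x => 1 + -1 * \1_A x) :> (Rd -> R).
  by apply/funext => x; rewrite !indicE in_setC; case: (x \in A) => /=; ring.
apply: adherentD; first exact/adherent_trig/real_trig_cst.
apply: (@adherentM _ _ _ _ `|-1|) => //.
exact/adherent_trig/real_trig_cst.
Qed.

Lemma adherent_setI A B : adherent_set A -> adherent_set B -> adherent_set (A `&` B).
Proof.
move=> [mA aA] [mB aB]; split; first exact: measurableI.
rewrite (_ : \1_(A `&` B) = (fun x => \1_A x * \1_B x)); last first.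
  by apply/funext => x; rewrite indicI.
by apply: adherentM aA _ aB => x; exact: indic_norm_le1.
Qed.

Lemma adherent_setU A B : adherent_set A -> adherent_set B -> adherent_set (A `|` B).
Proof.
move=> aA aB; rewrite -[_ `|` _]setCK setCU; apply: adherent_setC.
by apply: adherent_setI; exact: adherent_setC.
Qed.

Lemma adherent_set0 : adherent_set set0.
Proof.
split => //; rewrite indic0; exact/adherent_trig/real_trig_cst.
Qed.

Lemma adherent_set_cvg (A : set Rd) (g : nat -> Rd -> R) : measurable A ->
  (forall n, adherent (g n)) ->
  (forall n x, Y x -> `|g n x| <= 1) ->
  (forall x, Y x -> g ^~ x @ \oo --> (\1_A x : R)) -> adherent_set A.
Proof.
move=> mA ag g1 gA; split => //.
apply: (@adherent_cvg _ _ _ g (fun=> 2)) => //.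
- exact: L2_indic.
- exact: L2_cst.
- move=> n x Yx; rewrite (le_trans (ler_normB _ _))//.
  by rewrite (_ : 2 = 1 + 1 :> R)// lerD// ?indic_norm_le1// g1.
Qed.

(** At each point the indicators of the finite unions are eventually constant. *)
Lemma adherent_bigcup (F : (set Rd)^nat) :
  (forall n, adherent_set (F n)) -> adherent_set (\bigcup_n F n).
Proof.
move=> aF; pose G n := \bigcup_(i < n) F i.
have aG n : adherent_set (G n).
  rewrite /G bigcup_mkord; elim/big_ind: _ => //; first exact: adherent_set0.
  exact: adherent_setU.
apply: (@adherent_set_cvg _ (fun n => \1_(G n))).
- by apply: bigcupT_measurable => n; exact: (aF n).1.
- by move=> n; exact: (aG n).2.
- by move=> n x _; exact: indic_norm_le1.
- move=> x _; apply: cvg_near_cst; rewrite indicE.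
  have [[m _ Fm]|nF] := pselect ((\bigcup_n F n) x).
    near=> n; rewrite indicE !mem_set//; [by exists m|exists m => //=].
    by near: n; exists m.+1.
  near=> n; rewrite indicE !memNset// => -[m _ Fm].
  by apply: nF; exists m.
Unshelve. all: by end_near. Qed.

Lemma adherent_trig_pos q : real_trig q -> adherent_set [set x | 0 < q x].
Proof.
move=> tq; have [M M0 qM] := real_trig_bounded tq.
(* An affine image of [q] with values in the unit interval, placed so that [q > 0] becomes
   [u < 1/2], the side where [step_poly] tends to 1. *)
pose u x := 2^-1 + - (2 * M)^-1 * q x.
have tu : real_trig u.
  by apply: real_trigD; [exact: real_trig_cst|exact: real_trigZ].
have uE x : u x = 2^-1 - 2^-1 * (q x / M).
  by rewrite /u; field; exact: lt0r_neq0.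
have u01 x : 0 <= u x <= 1.
  have : `|q x / M| <= 1 by rewrite normrM normfV (gtr0_norm M0) ler_pdivrMr ?mul1r.
  by rewrite uE ler_norml => /andP[? ?]; apply/andP; split; lra.
have u2 x : (u x < 2^-1) = (0 < q x).
  by rewrite uE gtrBl pmulr_rgt0 ?invr_gt0// pmulr_lgt0// invr_gt0.
apply: (@adherent_set_cvg _ (fun n x => step_poly n (u x))).
- rewrite (_ : [set x | _] = setT `&` q @^-1` `]0, +oo[).
    by apply: measurable_real_trig => //; exact: measurable_itv.
  by rewrite setTI; apply/seteqP; split => x; rewrite /= in_itv/= andbT.
- move=> n; apply: adherent_trig; apply: real_trigX.
  under eq_fun do rewrite -mulN1r.
  by apply: real_trigD; [exact: real_trig_cst|apply: real_trigZ; exact: real_trigX].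
- move=> n x _; have /andP[s0 s1] := step_poly_itv n (u01 x).
  by rewrite ger0_norm.
- move=> x _; have := cvg_step_poly (u01 x); rewrite u2 indicE.
  rewrite (_ : (x \in _) = (0 < q x)); first by case: ifP.
  by apply/idP/idP; rewrite inE.
Qed.

Lemma dot_delta (i : 'I_d) (x : Rd) : dot (map_mx intr (delta_mx i 0 : 'cV[int]_d)) x = x i 0.
Proof.
rewrite /dot (bigD1 i)//= big1 ?addr0.
  by rewrite !mxE !eqxx/= mul1r.
by move=> j ji; rewrite !mxE (negbTE ji) mul0r.
Qed.

(** Only the trace on the cell matters. If [a] lies outside the open interval from [-1/2] to [1/2],
    the indicator is constant there; otherwise the ray agrees on the cell with the positivity set of
    a trigonometric polynomial. *)
Lemma adherent_ray (i : 'I_d) (a : R) : adherent_set [set x : Rd | x i 0 < a].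
Proof.
have mA : measurable [set x : Rd | x i 0 < a].
  rewrite (_ : [set x | _] = setT `&` (fun x : Rd => x i 0) @^-1` `]-oo, a[).
    by apply: measurable_coord => //; exact: measurable_itv.
  by rewrite setTI; apply/seteqP; split => x; rewrite /= in_itv.
split => //.
have [a1|a1] := lerP a (- 2^-1).
  apply: (@adherent_eqY _ _ (fun=> 0)); first exact: L2_indic.
    move=> x; rewrite inE => /(_ i)/andP[xi _]; rewrite indicE memNset//=.
    by apply/negP; rewrite -leNgt; lra.
  exact/adherent_trig/real_trig_cst.
have [a2|a2] := lerP 2^-1 a.
  apply: (@adherent_eqY _ _ (fun=> 1)); first exact: L2_indic.
    move=> x; rewrite inE => /(_ i)/andP[_ xi]; rewrite indicE mem_set//=.
    lra.
  exact/adherent_trig/real_trig_cst.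
pose e : 'cV[int]_d := delta_mx i 0.
(* This is [2 cos (pi x_i) sin (pi (a - x_i))]. Each factor has half a period, but the product is
   periodic; the cosine is positive on the cell, so the sign of [q] is that of [a - x_i]. *)
pose q (x : Rd) : R := sin (pi * a) * (1 + wave e 0 x) + cos (pi * a) * wave e (pi / 2) x.
have tq : real_trig q.
  apply: real_trigD; apply: real_trigZ; last exact: real_trig_wave.
  by apply: real_trigD; [exact: real_trig_cst|exact: real_trig_wave].
have qE x : q x = 2 * cos (pi * x i 0) * sin (pi * (a - x i 0)).
  rewrite /q /wave addr0 cosDpihalf dot_delta.
  rewrite (_ : 2 * pi * x i 0 = pi * x i 0 + pi * x i 0); last by ring.
  rewrite mulrBr sinB cosD sinD; have := cos2Dsin2 (pi * x i 0).
  move: (cos _) (sin _) => c s; move: (cos _) (sin _) => c' s' cs.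
  have -> : 1 + (c * c - s * s) = 2 * c ^+ 2 by rewrite -[X in X + _]cs; ring.
  ring.
apply: (@adherent_eqY _ _ (\1_[set x | 0 < q x])).
- exact: L2_indic.
- move=> x; rewrite inE => /(_ i)/andP[x1 x2]; rewrite !indicE; congr ((nat_of_bool _)%:R).
  have p0 := pi_gt0 R.
  have cx : 0 < cos (pi * x i 0).
    apply: cos_gt0_pihalf; apply/andP; split; nra.
  apply/idP/idP; rewrite !inE/= qE pmulr_rgt0 ?mulr_gt0//.
    rewrite ltNge => sp; rewrite ltNge; apply/negP => ax; move/negP: sp; apply.
    rewrite -oppr_ge0 -sinN; apply: sin_ge0_pi; apply/andP; split; nra.
  by move=> xa; apply: sin_gt0_pi; apply/andP; split; nra.
- by have [] := adherent_trig_pos tq.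
Qed.

End density_indicators.

(** * From rays to Borel sets and to all of L2 *)

Section density_L2.
Context (R : realType) (d : nat).
Local Notation Rd := 'cV[R]_d.
Local Notation Y := (@Y R d).
Local Notation mu := (leb R d).
Local Notation I f := (\int[mu]_(x in Y) f x).
Local Notation adherent := (@adherent R d).
Local Notation adherent_set := (@adherent_set R d).

(** Stated for preimages under a map, because it is used twice: for a coordinate, where rays
    generate, and for the map to tuples, where coordinate preimages generate. *)
Lemma sigma_algebra_adherent T' (phi : Rd -> T') :
  sigma_algebra setT [set B | adherent_set (phi @^-1` B)].
Proof.
split => /=.
- by rewrite preimage_set0; exact: adherent_set0.
- by move=> B aB; rewrite setTD preimage_setC; exact: adherent_setC.
- by move=> B aB; rewrite preimage_bigcup; exact: adherent_bigcup.
Qed.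

Lemma adherent_coord_preimage (i : 'I_d) (C : set R) : measurable C ->
  adherent_set ((fun x : Rd => x i 0) @^-1` C).
Proof.
have mE := RGenInftyO.measurableE R.
move=> mC; have {mC} : (RGenInftyO.G (R:=R)).-sigma.-measurable C by rewrite -mE.
apply: (smallest_sub (sigma_algebra_adherent (fun x : Rd => x i 0))) => _ [a ->] /=.
rewrite (_ : _ @^-1` _ = [set x : Rd | x i 0 < a]); first exact: adherent_ray.
by apply/seteqP; split => x; rewrite /= in_itv.
Qed.

Lemma adherent_measurable (A : set Rd) : measurable A -> adherent_set A.
Proof.
(* The sigma-algebra on columns is transported from tuples, so the set is rewritten as a preimage
   under the inverse bijection. *)
pose tup (x : Rd) : d.-tuple (measurableTypeR R) := [tuple x i 0 | i < d].
have -> : A = tup @^-1` (@col_of_tuple R d @^-1` A).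
  apply/seteqP; split => x; rewrite /= (_ : col_of_tuple (tup x) = x)//;
    by apply/colP => i; rewrite mxE tnth_mktuple.
rewrite {1}/measurable/= /measurable_cV/=.
rewrite (_ : @col_of_tuple R d @^-1` (tup @^-1` (@col_of_tuple R d @^-1` A)) =
   @col_of_tuple R d @^-1` A); last first.
  apply/seteqP; split => x; rewrite /= (_ : col_of_tuple (tup (col_of_tuple x)) = col_of_tuple x)//;
    by apply/colP => i; rewrite mxE tnth_mktuple.
apply: (smallest_sub (sigma_algebra_adherent tup)).
rewrite -bigcup_seq => B [i _ [C mC <-]] /=.
rewrite setTI (_ : _ @^-1` _ = (fun x : Rd => x i 0) @^-1` C).
  exact: adherent_coord_preimage.
by apply/seteqP; split => x; rewrite /= tnth_mktuple.
Qed.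

Import HBSimple HBNNSimple.

Lemma adherent_nnsfun (f : {nnsfun Rd >-> R}) : adherent f.
Proof.
rewrite (_ : (f : Rd -> R) = (fun x => \sum_(y \in range f) y * \1_(f @^-1` [set y]) x)); last first.
  by apply/funext => x; exact: fimfunE.
under eq_fun do rewrite fsbig_finite//=.
elim: (finmap.enum_fset _) => [|y s IH].
  by under eq_fun do rewrite big_nil; exact/adherent_trig/real_trig_cst.
under eq_fun do rewrite big_cons.
apply: adherentD => //.
apply: (@adherentM _ _ _ _ `|y|) => //; first exact/adherent_trig/real_trig_cst.
by apply: (adherent_measurable _).2; exact: measurable_sfunP.
Qed.

(** Simple functions increase to [f], and [f] itself dominates the errors. *)
Lemma adherent_ge0 (f : Rd -> R) : L2 f -> (forall x, 0 <= f x) -> adherent f.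
Proof.
move=> Lf f0; have [mf _] := Lf.
have mfe : measurable_fun setT (EFin \o f) by exact/measurable_EFinP.
have [g [ndg gf]] := approximation measurableT mfe (fun x _ => f0 x).
have gfR x : (fun n => g n x) @ \oo --> f x.
  by have /fine_cvgP[_] := gf x Logic.I.
apply: (@adherent_cvg _ _ _ (fun n => g n) f) => //.
- by move=> n; exact: adherent_nnsfun.
- move=> n x _.
  have gnf : g n x <= f x.
    rewrite -(cvg_lim (@Rhausdorff R) (gfR x)).
    apply: nondecreasing_cvgn_le; last by apply/cvg_ex; exists (f x).
    by move=> m m' mm'; have /lefP := ndg _ _ mm'; exact.
  by rewrite ger0_norm ?subr_ge0// gerBl.
Qed.

Lemma adherent_L2 (f : Rd -> R) : L2 f -> adherent f.
Proof.
move=> Lf; have [mf _] := Lf.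
have mp : measurable_fun setT (fun x => Num.max (f x) 0).
  by apply: measurable_maxr => //; exact: measurable_cst.
have mn : measurable_fun setT (fun x => Num.max (- f x) 0).
  by apply: measurable_maxr; [exact: measurable_funN|exact: measurable_cst].
have max_sqr (t : R) : `|Num.max t 0 ^+ 2| <= t ^+ 2.
  by rewrite ger0_norm ?sqr_ge0//; rewrite maxEle; case: ifP => _; rewrite ?expr0n ?lexx//= sqr_ge0.
have Lp : L2 (fun x => Num.max (f x) 0).
  split => //; apply: (le_integrableY (g := fun x => f x ^+ 2)) => //; last exact: Lf.2.
  exact: measurable_funX.
have Ln : L2 (fun x => Num.max (- f x) 0).
  split => //; apply: (le_integrableY (g := fun x => f x ^+ 2)); last 2 first.
  - exact: Lf.2.
  - by move=> x; rewrite -[leRHS]sqrrN.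
  - exact: measurable_funX.
rewrite (_ : f = (fun x => Num.max (f x) 0 + -1 * Num.max (- f x) 0)).
  apply: adherentD; first by apply: adherent_ge0 => // x; rewrite le_max lexx orbT.
  apply: (@adherentM _ _ _ _ `|-1|) => //; first exact/adherent_trig/real_trig_cst.
  by apply: adherent_ge0 => // x; rewrite le_max lexx orbT.
by apply/funext => x; rewrite !maxEle oppr_le0; case: ifPn; case: ifPn; rewrite -?ltNge => *; lra.
Qed.

End density_L2.

(** * Orthogonality of curl-free and divergence-free fields *)

Section vector_fields.
Context (R : realType) (d : nat).
Local Notation Rd := 'cV[R]_d.
Local Notation Zd := 'cV[int]_d.
Local Notation Y := (@Y R d).
Local Notation mu := (leb R d).
Local Notation I f := (\int[mu]_(x in Y) f x).
Implicit Types (u v w : Rd -> Rd).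

Lemma dotC (a b : Rd) : dot a b = dot b a.
Proof. by apply: eq_bigr => i _; rewrite mulrC. Qed.

Lemma dotDl (a b c : Rd) : dot (a + b) c = dot a c + dot b c.
Proof. by rewrite /dot -big_split; apply: eq_bigr => i _; rewrite mxE mulrDl. Qed.

Lemma dotZl t (a b : Rd) : dot (t *: a) b = t * dot a b.
Proof. by rewrite /dot mulr_sumr; apply: eq_bigr => i _; rewrite mxE mulrA. Qed.

Lemma dot_ge0 (a : Rd) : 0 <= dot a a.
Proof. by apply: sumr_ge0 => i _; rewrite -expr2 sqr_ge0. Qed.

Lemma dot_gt0 (a : Rd) : a != 0 -> 0 < dot a a.
Proof.
move=> a0; rewrite lt_neqAle dot_ge0 andbT; apply: contraNneq a0 => /esym/eqP.
rewrite psumr_eq0; last by move=> i _; rewrite -expr2 sqr_ge0.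
move=> /allP h; apply/eqP/colP => i; rewrite mxE.
by have := h i (mem_index_enum i); rewrite -expr2 sqrf_eq0 => /eqP.
Qed.

Definition L2v u : Prop := forall i, L2 (fun x => u x i 0).

Definition inner u v : R := I (fun x => dot (u x) (v x)).

(** One operation for sums, differences and variations; closure under it stands for being a linear
    subspace. *)
Definition lin u (c : R) v : Rd -> Rd := fun x => u x + c *: v x.

Lemma integralY_sum (J : Type) (s : seq J) (F : J -> Rd -> R) : (forall j, integrableY (F j)) ->
  integrableY (fun x => \sum_(j <- s) F j x) /\
  I (fun x => \sum_(j <- s) F j x) = \sum_(j <- s) I (F j).
Proof.
move=> hF; elim: s => [|j s [IH1 IH2]].
  under eq_fun do rewrite big_nil; rewrite big_nil; split; last exact: integralY_cst.
  by apply: (@integrableY_bounded _ _ _ 0) => // x; rewrite normr0.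
have -> : (fun x => \sum_(j0 <- j :: s) F j0 x) =
    (fun x => F j x + \sum_(j0 <- s) F j0 x).
  by apply/funext => x; rewrite big_cons.
by rewrite big_cons -IH2; split; [exact: integrableYD|rewrite integralYD].
Qed.

Lemma integrableY_dot u v : L2v u -> L2v v -> integrableY (fun x => dot (u x) (v x)).
Proof. by move=> Lu Lv; apply: (integralY_sum _ _).1 => i; exact: integrableY_mul. Qed.

Lemma inner_sum u v : L2v u -> L2v v -> inner u v = \sum_i I (fun x => u x i 0 * v x i 0).
Proof. by move=> Lu Lv; apply: (integralY_sum _ _).2 => i; exact: integrableY_mul. Qed.

Lemma innerC u v : inner u v = inner v u.
Proof. by apply: eq_Rintegral => x _; rewrite dotC. Qed.

Lemma inner_ge0 u : 0 <= inner u u.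
Proof. by apply: Rintegral_ge0 => x _; exact: dot_ge0. Qed.

Lemma L2v_lin u c v : L2v u -> L2v v -> L2v (lin u c v).
Proof.
move=> Lu Lv i; have := L2D (Lu i) (L2Z c (Lv i)).
by congr L2; apply/funext => x; rewrite /lin !mxE.
Qed.

Lemma L2v_cst (E : Rd) : L2v (cst E).
Proof. by move=> i; exact: L2_cst. Qed.

Lemma inner_linl u c v w : L2v u -> L2v v -> L2v w ->
  inner (lin u c v) w = inner u w + c * inner v w.
Proof.
move=> Lu Lv Lw; rewrite /inner -integralYZ; last exact: integrableY_dot.
rewrite -integralYD; [|exact: integrableY_dot|by apply: integrableYZ; exact: integrableY_dot].
by apply: eq_Rintegral => x _; rewrite /lin dotDl dotZl.
Qed.

Lemma inner_linr u c v w : L2v u -> L2v v -> L2v w ->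
  inner w (lin u c v) = inner w u + c * inner w v.
Proof. by move=> Lu Lv Lw; rewrite innerC inner_linl// ![inner _ w]innerC. Qed.

Lemma L2perP v : L2per v <-> Zperiodic v /\ L2v v.
Proof.
split=> -[pv hv]; split => // i.
  have [mv iv] := hv i; split => //; apply/integrableP; split.
    by apply/measurable_EFinP; apply: measurable_funTS; exact: measurable_funX.
  by under eq_integral do rewrite /= ger0_norm ?sqr_ge0//.
have [mv /integrableP[_ iv]] := hv i; split => //.
by under eq_integral do rewrite -[_ ^+ 2]ger0_norm ?sqr_ge0//.
Qed.

Definition coef v (k : Zd) th (i : 'I_d) : R := I (fun x => v x i 0 * wave k th x).

Lemma coef_lin u c v k th i : L2v u -> L2v v ->
  coef (lin u c v) k th i = coef u k th i + c * coef v k th i.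
Proof.
move=> Lu Lv; have Lw := L2_wave k th.
rewrite /coef -integralYZ; last exact: integrableY_mul.
rewrite -integralYD; [|exact: integrableY_mul|by apply: integrableYZ; exact: integrableY_mul].
by apply: eq_Rintegral => x _; rewrite /lin !mxE mulrDl mulrA.
Qed.

Lemma coef_phase v k th i : L2v v ->
  coef v k th i = cos th * coef v k 0 i + sin th * coef v k (pi / 2) i.
Proof.
move=> Lv; rewrite /coef -!integralYZ; try by apply: integrableY_mul => //; exact: L2_wave.
rewrite -integralYD; try by apply: integrableYZ; apply: integrableY_mul => //; exact: L2_wave.
by apply: eq_Rintegral => x _; rewrite wave_phase; ring.
Qed.

Lemma coef0 v th i : L2v v -> coef v 0 th i = cos th * I (fun x => v x i 0).
Proof.
move=> Lv; rewrite -integralYZ.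
  by apply: eq_Rintegral => x _; rewrite wave0 mulrC.
have := integrableY_mul (Lv i) (L2_cst _ 1).
by congr integrableY; apply/funext => x; rewrite mulr1.
Qed.

Lemma fourierE v k i :
  fourier v k i 0 = (coef v k 0 i +i* coef v k (pi / 2) i)%C.
Proof.
rewrite mxE /integralC; congr (_ +i* _)%C; apply: eq_Rintegral => x _.
  rewrite /phi /= mul0r subr0; congr (_ * _).
  by have := waveN k 0 x; rewrite oppr0 /wave !addr0.
rewrite /phi /= mul0r addr0; congr (_ * _).
have := waveN k (- (pi / 2)) x; rewrite opprK => <-; rewrite /wave.
by rewrite -[RHS]opprK -cosDpi -addrA (_ : - (pi / 2) + pi = pi / 2) ?cosDpihalf ?opprK//; field.
Qed.

Lemma Re_intM (z : int) (w : R[i]) : complex.Re (z%:~R * w) = z%:~R * complex.Re w.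
Proof. by rewrite -(rmorph_int (real_complex R)); case: w => a b /=; rewrite mul0r subr0. Qed.

Lemma Im_intM (z : int) (w : R[i]) : complex.Im (z%:~R * w) = z%:~R * complex.Im w.
Proof. by rewrite -(rmorph_int (real_complex R)); case: w => a b /=; rewrite mul0r addr0. Qed.

Lemma complex_eq0 (w : R[i]) : w = 0 <-> complex.Re w = 0 /\ complex.Im w = 0.
Proof. by split=> [->//|]; case: w => a b /= [-> ->]. Qed.

Lemma mean_eq0P v : L2v v -> mean v = 0 <-> forall i, I (fun x => v x i 0) = 0.
Proof.
move=> Lv; split=> [h i|h].
  have := congr1 (fun M : 'cV[R[i]]_d => complex.Re (M i 0)) h.
  by rewrite /mean fourierE mxE/= coef0// cos0 mul1r.
by apply/colP => i; rewrite /mean fourierE mxE !coef0// h !mulr0.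
Qed.

(** Real and imaginary parts of the complex equation are the phases [0] and [pi / 2]; any other
    phase is a combination of these two. *)
Lemma curl_freeP v : L2v v -> curl_free v <->
  forall (k : Zd) th i j, (k j 0)%:~R * coef v k th i = (k i 0)%:~R * coef v k th j.
Proof.
move=> Lv; split=> [h k th i j|h k i j].
  have /complex_eq0[] := h k i j.
  rewrite !raddfB/= !Re_intM !Im_intM !fourierE /=.
  move=> /subr0_eq h1 /subr0_eq h2.
  by rewrite ![coef v k th _]coef_phase// !mulrDr ![_%:~R * (_ * _)]mulrCA h1 h2.
apply/complex_eq0; rewrite !raddfB/= !Re_intM !Im_intM !fourierE /= !(h k _ i j).
by rewrite !subrr.
Qed.

Lemma div_freeP v : L2v v -> div_free v <->
  forall (k : Zd) th, \sum_i (k i 0)%:~R * coef v k th i = 0.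
Proof.
have E (k : Zd) : \sum_i (k i 0)%:~R * fourier v k i 0 =
    ((\sum_i (k i 0)%:~R * coef v k 0 i) +i*
     (\sum_i (k i 0)%:~R * coef v k (pi / 2) i))%C.
  apply/eqP; rewrite eq_complex !raddf_sum/=; apply/andP; split; apply/eqP;
    by apply: eq_bigr => i _; rewrite ?Re_intM ?Im_intM fourierE.
move=> Lv; split=> [h k th|h k]; last by rewrite E !h.
have := h k; rewrite E => -[h1 h2].
under eq_bigr do rewrite coef_phase// mulrDr ![_%:~R * (_ * _)]mulrCA.
by rewrite big_split/= -!mulr_sumr h1 h2 !mulr0 addr0.
Qed.

End vector_fields.

(** * Plane waves and the Helmholtz splitting *)

Section helmholtz.
Context (R : realType) (d : nat).
Local Notation Rd := 'cV[R]_d.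
Local Notation Zd := 'cV[int]_d.
Local Notation Y := (@Y R d).
Local Notation mu := (leb R d).
Local Notation I f := (\int[mu]_(x in Y) f x).
Local Notation toR k := (map_mx intr (k : Zd) : Rd).
Implicit Types (u v w e j : Rd -> Rd) (k : Zd).

Lemma spaceEP v : @spaceE R d v <-> [/\ Zperiodic v, L2v v,
  forall i, I (fun x => v x i 0) = 0 &
  forall k th i i', (k i' 0)%:~R * coef v k th i = (k i 0)%:~R * coef v k th i'].
Proof.
split=> [[/L2perP[pv Lv] mv cv]|[pv Lv mv cv]]; split=> //.
- exact/mean_eq0P.
- exact/curl_freeP.
- exact/L2perP.
- exact/mean_eq0P.
- exact/curl_freeP.
Qed.

Lemma spaceJP v : @spaceJ R d v <-> [/\ Zperiodic v, L2v v,
  forall i, I (fun x => v x i 0) = 0 &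
  forall k th, \sum_i (k i 0)%:~R * coef v k th i = 0].
Proof.
split=> [[/L2perP[pv Lv] mv cv]|[pv Lv mv cv]]; split=> //.
- exact/mean_eq0P.
- exact/div_freeP.
- exact/L2perP.
- exact/mean_eq0P.
- exact/div_freeP.
Qed.

Lemma spaceE_L2v e : @spaceE R d e -> L2v e. Proof. by case/spaceEP. Qed.

Lemma spaceJ_L2v j : @spaceJ R d j -> L2v j. Proof. by case/spaceJP. Qed.

Lemma integrableY_coord v i : L2v v -> integrableY (fun x => v x i 0).
Proof.
move=> Lv; have := integrableY_mul (Lv i) (L2_cst _ 1).
by congr integrableY; apply/funext => x; rewrite mulr1.
Qed.

Lemma Zperiodic_lin u c v : Zperiodic u -> Zperiodic v -> Zperiodic (lin u c v).
Proof. by move=> pu pv k x; rewrite /lin pu pv. Qed.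

Lemma integral_lin u c v i : L2v u -> L2v v ->
  I (fun x => lin u c v x i 0) = I (fun x => u x i 0) + c * I (fun x => v x i 0).
Proof.
move=> Lu Lv; rewrite -integralYZ; last exact: integrableY_coord.
rewrite -integralYD; [|exact: integrableY_coord|by apply: integrableYZ; exact: integrableY_coord].
by apply: eq_Rintegral => x _; rewrite /lin !mxE.
Qed.

Lemma spaceE_lin u c v : @spaceE R d u -> @spaceE R d v -> @spaceE R d (lin u c v).
Proof.
move=> /spaceEP[pu Lu mu0 cu] /spaceEP[pv Lv mv cv]; apply/spaceEP; split.
- exact: Zperiodic_lin.
- exact: L2v_lin.
- by move=> i; rewrite integral_lin// mu0 mv mulr0 addr0.
- move=> k th i i'; rewrite !coef_lin// !mulrDr cu; congr (_ + _).
  by rewrite mulrCA cv mulrCA.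
Qed.

Lemma spaceJ_lin u c v : @spaceJ R d u -> @spaceJ R d v -> @spaceJ R d (lin u c v).
Proof.
move=> /spaceJP[pu Lu mu0 cu] /spaceJP[pv Lv mv cv]; apply/spaceJP; split.
- exact: Zperiodic_lin.
- exact: L2v_lin.
- by move=> i; rewrite integral_lin// mu0 mv mulr0 addr0.
- move=> k th; under eq_bigr do rewrite coef_lin// mulrDr mulrCA.
  by rewrite big_split/= -mulr_sumr cu cv mulr0 addr0.
Qed.

Definition zero_field : Rd -> Rd := cst 0.

Lemma coef_zero k th i : coef zero_field k th i = 0.
Proof.
rewrite /coef -[RHS](@integralY_cst R d).
by apply: eq_Rintegral => x _; rewrite mxE mul0r.
Qed.

Lemma spaceJ0 : @spaceJ R d zero_field.
Proof.
apply/spaceJP; split=> //.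
- exact: L2v_cst.
- move=> i; rewrite -[RHS](@integralY_cst R d).
  by apply: eq_Rintegral => x _; rewrite mxE.
- by move=> k th; apply: big1 => i _; rewrite coef_zero mulr0.
Qed.

(** For [k != 0] it is a gradient when the amplitude [m] is parallel to [k], and divergence-free
    when [m] is orthogonal to [k]. *)
Definition plane_wave (m : Rd) k th : Rd -> Rd := fun x => wave k th x *: m.

Lemma Zperiodic_plane_wave m k th : Zperiodic (plane_wave m k th).
Proof. by move=> l x; rewrite /plane_wave wave_Zperiodic. Qed.

Lemma L2v_plane_wave m k th : L2v (plane_wave m k th).
Proof.
move=> i; have := L2Z (m i 0) (L2_wave k th).
by congr L2; apply/funext => x; rewrite mxE mulrC.
Qed.

Lemma integral_plane_wave m k th i : k != 0 -> I (fun x => plane_wave m k th x i 0) = 0.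
Proof.
move=> k0.
under eq_Rintegral do rewrite mxE mulrC.
rewrite integralYZ; last by apply: (@integrableY_bounded _ _ _ 1) => [|x]; [exact: measurable_wave|exact: wave_le1].
by rewrite integral_wave (negbTE k0) mulr0.
Qed.

Lemma coef_plane_wave m k th l th' i : coef (plane_wave m k th) l th' i =
  m i 0 * I (fun x => wave k th x * wave l th' x).
Proof.
rewrite -integralYZ; last by apply: integrableY_mul; exact: L2_wave.
by apply: eq_Rintegral => x _; rewrite mxE; ring.
Qed.

(* Two waves interact only when their frequencies agree up to sign. *)
Lemma wave_collinear k l th th' : I (fun x => wave k th x * wave l th' x) != 0 ->
  exists s : int, l = s *: k.
Proof.
rewrite integral_waveM; have [kl _|_] := eqVneq (k + l) 0.
  by exists (-1); rewrite scaleN1r; apply/eqP; rewrite -addr_eq0 addrC kl.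
have [-> _|_] := eqVneq k l; first by exists 1; rewrite scale1r.
by rewrite !mulr0 addr0 eqxx.
Qed.

Lemma spaceE_plane_wave k th : k != 0 -> @spaceE R d (plane_wave (toR k) k th).
Proof.
move=> k0; apply/spaceEP; split.
- exact: Zperiodic_plane_wave.
- exact: L2v_plane_wave.
- by move=> i; exact: integral_plane_wave.
- move=> l th' i i'; rewrite !coef_plane_wave.
  set J := \int[_]_(_ in _) _; have [->|J0] := eqVneq J 0; first by rewrite !mulr0.
  by have [s ->] := wave_collinear J0; rewrite !mxE !intrM; ring.
Qed.

Lemma spaceJ_plane_wave m k th : k != 0 -> dot (toR k) m = 0 ->
  @spaceJ R d (plane_wave m k th).
Proof.
move=> k0 km; apply/spaceJP; split.
- exact: Zperiodic_plane_wave.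
- exact: L2v_plane_wave.
- by move=> i; exact: integral_plane_wave.
- move=> l th'; under eq_bigr do rewrite coef_plane_wave mulrA.
  rewrite -mulr_suml.
  set J := \int[_]_(_ in _) _; have [->|J0] := eqVneq J 0; first by rewrite mulr0.
  have [s ->] := wave_collinear J0.
  rewrite (_ : \sum_i _ = s%:~R * dot (toR k) m); first by rewrite km mulr0 mul0r.
  by rewrite /dot mulr_sumr; apply: eq_bigr => i _; rewrite !mxE intrM mulrA.
Qed.

Lemma inner_plane_wave v m k th : L2v v ->
  inner v (plane_wave m k th) = \sum_i m i 0 * coef v k th i.
Proof.
move=> Lv; rewrite inner_sum//; last exact: L2v_plane_wave.
apply: eq_bigr => i _; rewrite /coef -integralYZ; last by apply: integrableY_mul => //; exact: L2_wave.
by apply: eq_Rintegral => x _; rewrite mxE; ring.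
Qed.

Lemma inner_cst v (E : Rd) : L2v v ->
  inner v (cst E) = \sum_i E i 0 * I (fun x => v x i 0).
Proof.
move=> Lv; rewrite inner_sum//; last exact: L2v_cst.
apply: eq_bigr => i _; rewrite -integralYZ; last exact: integrableY_coord.
by apply: eq_Rintegral => x _; rewrite mulrC.
Qed.

Lemma spaceE_perp_cst e (E : Rd) : @spaceE R d e -> inner e (cst E) = 0.
Proof.
by move=> /spaceEP[_ Le me _]; rewrite inner_cst// big1// => i _; rewrite me mulr0.
Qed.

Lemma spaceJ_perp_cst j (E : Rd) : @spaceJ R d j -> inner j (cst E) = 0.
Proof.
by move=> /spaceJP[_ Le me _]; rewrite inner_cst// big1// => i _; rewrite me mulr0.
Qed.

(** Choose a nonzero component of [k], say at [i0]. Multiplied by it, the product becomes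
    [coef e k th i0] times [k.m], because the curl condition exchanges the indices. *)
Lemma spaceE_perp_plane_wave e m k th : @spaceE R d e -> k != 0 ->
  dot (toR k) m = 0 -> inner e (plane_wave m k th) = 0.
Proof.
move=> /spaceEP[_ Le _ ce] k0 km; rewrite inner_plane_wave//.
have [i0 ki0] : exists i, k i 0 != 0.
  apply/existsP; apply: contraR k0; rewrite negb_exists => /forallP h.
  by apply/eqP/colP => i; rewrite mxE; apply/eqP; rewrite -[_ == _]negbK.
suff /eqP : (k i0 0)%:~R * (\sum_i m i 0 * coef e k th i) = 0.
  by rewrite mulf_eq0 intr_eq0 (negbTE ki0) => /eqP.
rewrite mulr_sumr; under eq_bigr => i _ do rewrite mulrCA (ce k th i i0) mulrA [m i 0 * _]mulrC.
rewrite -mulr_suml (_ : \sum_i _ = dot (toR k) m); first by rewrite km mul0r.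
by apply: eq_bigr => i _; rewrite mxE.
Qed.

Lemma spaceJ_perp_plane_wave j k th : @spaceJ R d j ->
  inner j (plane_wave (toR k) k th) = 0.
Proof.
move=> /spaceJP[_ Lj _ dj]; rewrite inner_plane_wave// -[RHS](dj k th).
by apply: eq_bigr => i _; rewrite mxE.
Qed.

(* A field with its [spaceJ] part [q]; [r] collects the mean and the gradients. *)
Definition splits v : Prop := exists q r,
  [/\ v = lin q 1 r, @spaceJ R d q, forall e, @spaceE R d e -> inner e q = 0,
      L2v r & forall j, @spaceJ R d j -> inner j r = 0].

Lemma splits_lin u c v : splits u -> splits v -> splits (lin u c v).
Proof.
move=> [q [r [-> Jq Eq Lr Jr]]] [q' [r' [-> Jq' Eq' Lr' Jr']]].
exists (lin q c q'), (lin r c r'); split.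
- apply/funext => x; rewrite /lin !scale1r scalerDr.
  by rewrite addrACA.
- exact: spaceJ_lin.
- move=> e Ee; rewrite inner_linr ?Eq ?Eq' ?mulr0 ?addr0//;
  by [exact: spaceJ_L2v|exact: spaceE_L2v].
- exact: L2v_lin.
- by move=> j Jj; rewrite inner_linr ?Jr ?Jr' ?mulr0 ?addr0//; exact: spaceJ_L2v.
Qed.

(** The amplitude is projected onto [k] and onto its orthogonal complement. A wave of frequency zero
    is constant and goes entirely into [r]. *)
Lemma splits_plane_wave m k th : splits (plane_wave m k th).
Proof.
have [->|k0] := eqVneq k 0.
  exists zero_field, (cst (cos th *: m)); split.
  - by apply/funext => x; rewrite /plane_wave /lin wave0 scale1r add0r.
  - exact: spaceJ0.
  - by move=> e; exact: spaceE_perp_cst.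
  - exact: L2v_cst.
  - by move=> j; exact: spaceJ_perp_cst.
have kk : 0 < dot (toR k) (toR k).
  apply: dot_gt0; apply: contraNneq k0 => /colP h.
  by apply/eqP/colP => i; have := h i; rewrite !mxE => /eqP; rewrite intr_eq0 => /eqP.
pose c := dot (toR k) m / dot (toR k) (toR k).
have perp : dot (toR k) (m - c *: toR k) = 0.
  rewrite dotC dotDl -scaleNr dotZl [dot m _]dotC /c; field; exact: lt0r_neq0.
exists (plane_wave (m - c *: toR k) k th), (fun x => lin zero_field c (plane_wave (toR k) k th) x); split.
- apply/funext => x; apply/colP => i.
  by rewrite /plane_wave /lin !mxE; ring.
- exact: spaceJ_plane_wave.
- by move=> e Ee; exact: spaceE_perp_plane_wave.
- by apply: L2v_lin; [exact: L2v_cst|exact: L2v_plane_wave].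
- move=> j Jj; rewrite inner_linr ?spaceJ_perp_plane_wave ?spaceJ_perp_cst ?mulr0 ?addr0//;
  by [exact: L2v_cst|exact: L2v_plane_wave|exact: spaceJ_L2v].
Qed.

Lemma splits_trig (p : 'I_d -> Rd -> R) : (forall i, real_trig (p i)) ->
  splits (fun x => \col_i p i x).
Proof.
move=> tp.
have s1 f (m : Rd) : real_trig f -> splits (fun x => f x *: m).
  elim=> [k th|f1 f2 _ h1 _ h2|c g _ h]; first exact: splits_plane_wave.
    have := splits_lin 1 h1 h2; congr splits; apply/funext => x.
    by rewrite /lin scale1r scalerDl.
  (* Scaling by [c] is written as [g + (c - 1) g], a shape that [lin] covers. *)
  have := splits_lin (c - 1) h h; congr splits; apply/funext => x.
  by rewrite /lin scalerA -scalerDl; congr (_ *: _); ring.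
rewrite (_ : (fun x => _) = (fun x => \sum_(i <- index_enum 'I_d) p i x *: delta_mx i 0)).
  elim: (index_enum _) => [|i s IH].
    have := s1 (fun=> 0) 0 (real_trig_cst _ 0); congr splits; apply/funext => x.
    by rewrite big_nil scale0r.
  have := splits_lin 1 (s1 _ (delta_mx i 0) (tp i)) IH; congr splits; apply/funext => x.
  by rewrite big_cons /lin scale1r.
apply/funext => x; apply/colP => i; rewrite mxE summxE (bigD1 i)//= big1.
  by rewrite !mxE !eqxx/= mulr1 addr0.
by move=> i' ii'; rewrite !mxE eq_sym (negbTE ii') mulr0.
Qed.

(** The test value [t = - a / (N + 1)] makes the expression equal to [- a^2 (N + 2) / (N + 1)^2];
    the shift by 1 covers [N = 0]. This extracts first-order conditions from inequalities. *)
Lemma quadratic_ge0_linear_eq0 (a N : R) : 0 <= N ->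
  (forall t, 0 <= t ^+ 2 * N + 2 * t * a) -> a = 0.
Proof.
move=> N0 h; have := h (- a / (N + 1)).
have N1 : 0 < N + 1 by lra.
rewrite (_ : _ + _ = - (a ^+ 2 * (N + 2) / (N + 1) ^+ 2)); last by field; exact: lt0r_neq0.
rewrite oppr_ge0 pmulr_lle0 ?invr_gt0 ?exprn_gt0// pmulr_lle0; last by lra.
by move=> a2; apply/eqP; rewrite -sqrf_eq0 eq_le a2 sqr_ge0.
Qed.

Lemma inner_sqr_lin u c v : L2v u -> L2v v ->
  inner (lin u c v) (lin u c v) = inner u u + 2 * c * inner u v + c ^+ 2 * inner v v.
Proof.
move=> Lu Lv; have Lw := L2v_lin c Lu Lv.
by rewrite inner_linl// !inner_linr// [inner v u]innerC; ring.
Qed.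

(* The distance of [j] to the [spaceJ] part of a trigonometric approximation is
   at most its distance to the approximation itself, and that part does not
   contribute to the product with [e]. *)
Lemma spaceE_perp_spaceJ e j : @spaceE R d e -> @spaceJ R d j -> inner e j = 0.
Proof.
move=> Ee Jj; have Le := spaceE_L2v Ee; have Lj := spaceJ_L2v Jj.
apply: (quadratic_ge0_linear_eq0 (inner_ge0 e)) => t.
(* Up to [eps], the inequality is the nonnegativity of the squared norm of [w + t e], where [w] has
   squared norm below [eps] and the same product with [e] as [j]. *)
rewrite -[leLHS]addr0 -lerBlDr; apply/ler_addgt0Pr => eps eps0.
(* With [d.+1] the [d] coordinate errors add up to strictly less than [eps]. *)
have a0 : 0 < eps / d.+1%:R by rewrite divr_gt0.
have /choice[p hp] : forall i, exists p, real_trig p /\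
    I (fun x => (j x i 0 - p x) ^+ 2) < eps / d.+1%:R.
  by move=> i; have [_ /(_ _ a0)[p tp pe]] := adherent_L2 (Lj i); exists p.
have tp i := (hp i).1.
have [q [r [pE Jq Eq Lr Jr]]] := splits_trig tp.
pose w := lin j (-1) q.
have Jw : @spaceJ R d w by exact: spaceJ_lin.
have Lw := spaceJ_L2v Jw; have Lq := spaceJ_L2v Jq.
have ww : inner w w < eps.
  have wr : inner (lin w (-1) r) (lin w (-1) r) < eps.
    rewrite inner_sum; try exact: L2v_lin.
    apply: (@le_lt_trans _ _ (\sum_(i < d) eps / d.+1%:R)).
      apply: ler_sum => i _; apply: le_trans (ltW (hp i).2).
      rewrite le_eqVlt; apply/orP; left; apply/eqP; apply: eq_Rintegral => x _.
      have := congr1 (fun f : Rd -> Rd => f x i 0) pE.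
      by rewrite /w /lin !mxE => ->; ring.
    rewrite sumr_const card_ord -[_ *+ d]mulr_natr mulrAC ltr_pdivrMr// ltr_pM2l//.
    by rewrite ltr_nat.
  apply: le_lt_trans wr; rewrite inner_sqr_lin// Jr// mulr0 addr0 sqrrN expr1n mul1r.
  by rewrite lerDl inner_ge0.
have ew : inner e w = inner e j by rewrite inner_linr// Eq// mulr0 addr0.
have := inner_ge0 (lin w t e); rewrite inner_sqr_lin// [inner w e]innerC ew.
lra.
Qed.

End helmholtz.

(** * Homogenized matrices *)

Section elliptic_matrices.
Context (R : realType) (d : nat).
Local Notation Rd := 'cV[R]_d.
Implicit Types (M : 'M[R]_d) (v w : Rd).

Lemma dot_mx v w : dot v w = (v^T *m w) 0 0.
Proof. by rewrite mxE; apply: eq_bigr => i _; rewrite mxE. Qed.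

Lemma dot_sym M v w : M^T = M -> dot (M *m v) w = dot v (M *m w).
Proof. by move=> MT; rewrite !dot_mx trmx_mul MT mulmxA. Qed.

Lemma dotDr v w w' : dot v (w + w') = dot v w + dot v w'.
Proof. by rewrite ![dot v _]dotC dotDl. Qed.

Lemma dotZr t v w : dot v (t *: w) = t * dot v w.
Proof. by rewrite ![dot v _]dotC dotZl. Qed.

Lemma dot_delta_mx v i : dot v (delta_mx i 0) = v i 0.
Proof.
rewrite /dot (bigD1 i)//= big1 ?addr0 ?mxE ?eqxx ?mulr1//.
by move=> j ji; rewrite mxE (negbTE ji) mulr0.
Qed.

Lemma dot_mx_lin M v w t : M^T = M ->
  dot (M *m (v + t *: w)) (v + t *: w) =
  dot (M *m v) v + 2 * t * dot (M *m v) w + t ^+ 2 * dot (M *m w) w.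
Proof.
move=> MT; rewrite mulmxDr -scalemxAr !dotDl !dotDr !dotZl !dotZr.
by rewrite (dot_sym w v MT) [dot w _]dotC; ring.
Qed.

Lemma definite_unitmx M : M^T = M ->
  (forall v, v != 0 -> 0 < dot (M *m v) v) -> M \in unitmx.
Proof.
move=> MT Mpos; rewrite unitmxE unitfE; apply/negP => /det0P[v v0 vM].
have := Mpos v^T; rewrite trmx_eq0 => /(_ v0).
by rewrite -[M]MT -trmx_mul vM trmx0 dot_mx trmx0 mul0mx mxE ltxx.
Qed.

Lemma trmx_invmx M : M^T = M -> (invmx M)^T = invmx M.
Proof. by move=> MT; rewrite trmx_inv MT. Qed.

Definition elliptic (c C : R) M : Prop :=
  M^T = M /\ forall v, c * dot v v <= dot (M *m v) v <= C * dot v v.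

Lemma elliptic_unitmx c C M : 0 < c -> elliptic c C M -> M \in unitmx.
Proof.
move=> c0 [MT h]; apply: definite_unitmx => // v v0.
by have /andP[+ _] := h v; apply: lt_le_trans; rewrite mulr_gt0// dot_gt0.
Qed.

(** Two completed squares, with [M v = w]. The lower bound comes from the nonnegative [M]-energy of
    [v - C^-1 w] and the upper bound of [M] at [w]; the upper bound from the squared norm of
    [w - c v] and the lower bound of [M] at [v]. *)
Lemma elliptic_invmx c C M : 0 < c -> 0 < C -> elliptic c C M ->
  elliptic C^-1 c^-1 (invmx M).
Proof.
move=> c0 C0 eM; have uM := elliptic_unitmx c0 eM; have [MT h] := eM.
split=> [|w]; first exact: trmx_invmx.
pose v := invmx M *m w; have Mv : M *m v = w by rewrite mulKVmx.
rewrite -/v; apply/andP; split.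
  have := dot_mx_lin v w (- C^-1) MT; rewrite Mv => E.
  have /andP[+ _] := h (v + (- C^-1) *: w); rewrite E => l1.
  have /andP[_ l2] := h w.
  have l0 := dot_ge0 (v + - C^-1 *: w).
  have l3 : C^-1 ^+ 2 * dot (M *m w) w <= C^-1 * dot w w.
    rewrite expr2 -mulrA ler_pM2l ?invr_gt0//.
    by rewrite mulrC ler_pdivrMr// mulrC.
  have l4 : 0 <= dot w v + 2 * - C^-1 * dot w w + (- C^-1) ^+ 2 * dot (M *m w) w.
    by apply: le_trans l1; rewrite mulr_ge0// ltW.
  by rewrite [dot v w]dotC; move: l4; rewrite sqrrN; lra.
have /andP[l1 _] := h v; rewrite Mv in l1.
have := dot_ge0 (w + (- c) *: v).
rewrite dotDl !dotDr !dotZl !dotZr [dot v w]dotC => l2.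
rewrite [leRHS]mulrC ler_pdivlMr// mulrC.
nra.
Qed.

(** Positivity at the sum and the difference of two unit vectors gives [2 |M i j| <= M i i + M j j],
    and diagonal entries are at most [C]. *)
Lemma elliptic_entry c C M i j : 0 <= c -> elliptic c C M -> `|M i j| <= C.
Proof.
move=> c0 [MT h].
have E k l : dot (M *m delta_mx l 0) (delta_mx k 0) = M k l.
  by rewrite dot_delta_mx -colE mxE.
have dd (k : 'I_d) : dot (delta_mx k 0) (delta_mx k 0) = 1 :> R.
  by rewrite dot_delta_mx mxE !eqxx.
have hi := h (delta_mx i 0); have hj := h (delta_mx j 0).
move: hi hj; rewrite !E !dd !mulr1 => /andP[_ hi] /andP[_ hj].
have pos v : 0 <= dot (M *m v) v.
  by have /andP[+ _] := h v; apply: le_trans; rewrite mulr_ge0// dot_ge0.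
have p1 := pos (delta_mx j 0 + 1 *: delta_mx i 0).
have p2 := pos (delta_mx j 0 + (-1) *: delta_mx i 0).
move: p1 p2; rewrite !dot_mx_lin// !E sqrrN !expr1n => p1 p2.
by rewrite ler_norml; apply/andP; split; lra.
Qed.

Lemma spd_unitmx M : spd M -> M \in unitmx.
Proof. by case=> MT Mpos; exact: definite_unitmx. Qed.

Lemma spd_invmx M : spd M -> spd (invmx M).
Proof.
move=> sM; have uM := spd_unitmx sM; have [MT Mpos] := sM.
split=> [|w w0]; first exact: trmx_invmx.
pose v := invmx M *m w; have Mv : M *m v = w by rewrite mulKVmx.
rewrite -/v dotC -Mv; apply: Mpos; apply: contraNneq w0 => v0.
by rewrite -Mv v0 mulmx0.
Qed.

(** With [M v = u = L w], expand the nonnegative [L]-energy of [w - v] and bound its term in [v]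
    alone by [M v.v = u.v]. *)
Lemma lowner_invmx L M : lowner_le L M -> lowner_le (invmx M) (invmx L).
Proof.
move=> [sL sM LM]; split; [exact: spd_invmx|exact: spd_invmx|move=> u].
pose v := invmx M *m u; pose w := invmx L *m u.
have Mv : M *m v = u by rewrite mulKVmx// spd_unitmx.
have Lw : L *m w = u by rewrite mulKVmx// spd_unitmx.
rewrite -/v -/w.
have h : 0 <= dot (L *m (w + (-1) *: v)) (w + (-1) *: v).
  have [->|n0] := eqVneq (w + (-1) *: v) 0; last by apply/ltW/sL.2.
  by rewrite mulmx0 dot_mx trmx0 mul0mx mxE.
rewrite dot_mx_lin ?Lw in h; last exact: sL.1.
have := LM v; rewrite Mv [dot w u]dotC [dot v u]dotC.
by rewrite sqrrN expr1n in h; lra.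
Qed.

End elliptic_matrices.

(** * Measurability of the inverse matrix, by cofactors *)

Section measurable_inverse.
Context d0 (T : measurableType d0) (R : realType).

(** The reciprocal is [f] times a real power of [f ^+ 2], whose base is nonnegative; where [f]
    vanishes, both sides are zero because [0^-1 = 0]. *)
Lemma measurable_funV (f : T -> R) : measurable_fun setT f ->
  measurable_fun setT (fun x => (f x)^-1).
Proof.
move=> mf; rewrite (_ : (fun x => _) = (fun x => f x * (f x ^+ 2) `^ (-1))).
  apply: measurable_funM => //.
  apply: (@measurableT_comp _ _ _ _ _ _ (@powR R ^~ (-1))).
    exact: measurable_powR.
  exact: measurable_funX.
apply/funext => x; rewrite powR_inv1 ?sqr_ge0//.
have [->|f0] := eqVneq (f x) 0; first by rewrite invr0 mul0r.
by field.
Qed.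

Lemma measurable_det n (G : T -> 'M[R]_n) :
  (forall i j, measurable_fun setT (fun x => G x i j)) ->
  measurable_fun setT (fun x => \det (G x)).
Proof.
move=> mG; apply: measurable_sum => s; apply: measurable_funM => //.
by apply: measurable_prod => i _; exact: mG.
Qed.

Lemma measurable_invmx n (G : T -> 'M[R]_n) :
  (forall i j, measurable_fun setT (fun x => G x i j)) ->
  (forall x, G x \in unitmx) ->
  forall i j, measurable_fun setT (fun x => invmx (G x) i j).
Proof.
move=> mG uG i j.
rewrite (_ : (fun x => _) = (fun x => (\det (G x))^-1 *
    ((-1) ^+ (j + i) * \det (row' j (col' i (G x)))))).
  apply: measurable_funM; first exact/measurable_funV/measurable_det.
  apply: measurable_funM => //.
  by apply: measurable_det => k l; under eq_fun do rewrite !mxE; exact: mG.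
by apply/funext => x; rewrite /invmx uG !mxE.
Qed.

End measurable_inverse.

(** * Borel representatives, energies and Euler equations *)

Section homogenization.
Context (R : realType) (d : nat).
Local Notation Rd := 'cV[R]_d.
Local Notation Zd := 'cV[int]_d.
Local Notation Y := (@Y R d).
Local Notation mu := (leb R d).
Local Notation I f := (\int[mu]_(x in Y) f x).
Implicit Types (u v w e : Rd -> Rd) (A F : Rd -> 'M[R]_d) (V : set (Rd -> Rd)).

Record borel_field (c C : R) F : Prop := {
  borel_c : 0 < c;
  borel_C : 0 < C;
  borel_elliptic : forall x, elliptic c C (F x);
  borel_measurable : forall i j, measurable_fun setT (fun x => F x i j);
  borel_periodic : Zperiodic F }.

Lemma borel_field_inv c C F : borel_field c C F ->
  borel_field C^-1 c^-1 (inv_field F).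
Proof.
move=> [c0 C0 eF mF pF]; split; rewrite ?invr_gt0//.
- by move=> x; exact: elliptic_invmx.
- by apply: measurable_invmx => // x; exact: elliptic_unitmx c0 (eF x).
- by move=> k x; rewrite /inv_field pF.
Qed.

(** The representative of [x] modulo integer vectors in the half-open cell; composing with it makes
    a field periodic without changing it on [Y]. *)
Definition wrap (x : Rd) : Rd := \col_i (x i 0 - (Num.floor (x i 0 + 2^-1))%:~R).

Lemma measurable_wrap : measurable_fun setT wrap.
Proof.
apply: measurable_to_cV => i; under eq_fun do rewrite mxE.
apply: measurable_funB; first exact: measurable_coord.
have mfloor : measurable_fun setT (fun t : R => (Num.floor t)%:~R : R).
  by apply: nondecreasing_measurable => // s t st; rewrite ler_int le_floor.
apply: (measurableT_comp mfloor).
by apply: measurable_funD; [exact: measurable_coord|exact: measurable_cst].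
Qed.

Lemma wrap_periodic : Zperiodic wrap.
Proof.
move=> k x; apply/colP => i; rewrite !mxE.
rewrite [_ + 2^-1]addrAC floorDrz ?intr_int// intrKfloor rmorphD/=; ring.
Qed.

Lemma wrap_id x : Y x -> wrap x = x.
Proof.
move=> Yx; apply/colP => i; rewrite mxE.
have /andP[x1 x2] := Yx i.
rewrite (@floor_def _ _ 0) ?subr0// add0r; apply/andP; split; lra.
Qed.

(* The entries of [A] are Borel off a null set [N], where [c%:M] replaces them;
   [wrap] makes the result periodic. *)
Lemma coefficient_field_borel A : coefficient_field A ->
  exists F c C, borel_field c C F /\ {ae mu, forall x, Y x -> A x = F x}.
Proof.
move=> [_ spdA LA [c [C [c0 cC ellA]]] _].
have /choice[G hG] : forall i, exists g : 'I_d -> Rd -> R, forall j,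
    measurable_fun setT (g j) /\ {ae mu, forall x, Y x -> A x i j = g j x}.
  move=> i; have /choice[g hg] : forall j, exists g : Rd -> R,
      measurable_fun setT g /\ {ae mu, forall x, Y x -> A x i j = g x}.
    by move=> j; have [[g mg Ag] _] := LA i j; exists g.
  by exists g.
have aeG : {ae mu, forall x i j, Y x -> A x i j = G i j x}.
  by apply: filter_forall => i; apply: filter_forall => j; exact: (hG i j).2.
have [N [mN N0 subN]] : {ae mu, forall x, Y x -> (forall i j, A x i j = G i j x) /\
    forall v : Rd, c * dot v v <= dot (A x *m v) v <= C * dot v v}.
  near=> x => Yx; split; last by move: Yx; near: x; exact: ellA.
  by move=> i j; move: i j Yx; near: x; exact: aeG.
have good x : (Y `\` N) x -> (forall i j, A x i j = G i j x) /\
    forall v : Rd, c * dot v v <= dot (A x *m v) v <= C * dot v v.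
  by move=> [Yx]; apply: contra_notP => h; apply: subN => /(_ Yx).
have mD : measurable (Y `\` N) by apply: measurableD => //; exact: measurable_Y.
pose F0 x : 'M[R]_d := if x \in Y `\` N then A x else c%:M.
have eF0 x : elliptic c C (F0 x).
  rewrite /F0; case: ifPn => [|_]; rewrite ?inE.
    by move=> Dx; split; [exact: (spdA x Dx.1).1|exact: (good x Dx).2].
  split=> [|v]; first exact: tr_scalar_mx.
  by rewrite mul_scalar_mx dotZl lexx ler_wpM2r// dot_ge0.
have mF0 i j : measurable_fun setT (fun x => F0 x i j).
  rewrite (_ : (fun x => _) = (fun x => \1_(Y `\` N) x * G i j x +
      (1 - \1_(Y `\` N) x) * (c%:M i j : R))).
    apply: measurable_funD; apply: measurable_funM => //.
    - exact: (hG i j).1.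
    - by apply: measurable_funB => //; exact: measurable_cst.
  apply/funext => x; rewrite /F0 indicE; case: ifPn => [|_].
    by rewrite inE => /good[-> _]; rewrite mul1r subrr mul0r addr0.
  by rewrite mul0r add0r subr0 mul1r.
exists (F0 \o wrap), c, C; split.
  split => //=; first exact: lt_le_trans cC.
  - by move=> i j; exact: measurableT_comp (mF0 i j) measurable_wrap.
  - by move=> k x; rewrite /= wrap_periodic.
exists N; split => // x /= /not_implyP[Yx]; apply: contra_notP => Nx.
by rewrite wrap_id// /F0 mem_set.
Unshelve. all: by end_near. Qed.

Definition apply_field F u : Rd -> Rd := fun x => F x *m u x.

Lemma L2v_apply_field c C F u : borel_field c C F -> L2v u -> L2v (apply_field F u).
Proof.
move=> [c0 C0 eF mF _] Lu i.
have -> : (fun x => apply_field F u x i 0) = (fun x => \sum_j F x i j * u x j 0).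
  by apply/funext => x; rewrite mxE.
elim: (index_enum _) => [|j s IH].
  by under eq_fun do rewrite big_nil; exact: L2_cst.
under eq_fun do rewrite big_cons; apply: L2D => //.
apply: (@L2M_bounded _ _ _ _ C) => // x.
exact: elliptic_entry (ltW c0) (eF x).
Qed.

Lemma apply_field_lin F u t v : apply_field F (lin u t v) = lin (apply_field F u) t (apply_field F v).
Proof. by apply/funext => x; rewrite /apply_field /lin mulmxDr scalemxAr. Qed.

Lemma inner_app_sym c C F u v : borel_field c C F ->
  inner (apply_field F u) v = inner u (apply_field F v).
Proof.
move=> bF; apply: eq_Rintegral => x _; apply: dot_sym.
exact: (borel_elliptic bF x).1.
Qed.

Lemma inner_app_lin c C F u t v : borel_field c C F -> L2v u -> L2v v ->
  inner (apply_field F (lin u t v)) (lin u t v) =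
  inner (apply_field F u) u + 2 * t * inner (apply_field F u) v + t ^+ 2 * inner (apply_field F v) v.
Proof.
move=> bF Lu Lv; have La w := @L2v_apply_field _ _ _ w bF.
rewrite apply_field_lin inner_linl; try by (exact: La) || exact: L2v_lin.
rewrite !inner_linr//; try exact: La.
by rewrite (inner_app_sym v u bF) [inner v _]innerC; ring.
Qed.

Lemma inner_app_ge c C F u : borel_field c C F -> L2v u ->
  c * inner u u <= inner (apply_field F u) u.
Proof.
move=> bF Lu; rewrite /inner -integralYZ; last exact: integrableY_dot.
apply: le_integralY.
- by apply: integrableYZ; exact: integrableY_dot.
- by apply: integrableY_dot => //; exact: L2v_apply_field bF _.
- by move=> x _; have /andP[] := (borel_elliptic bF x).2 (u x).
Qed.

Lemma inner_app_ge0 c C F u : borel_field c C F -> L2v u -> 0 <= inner (apply_field F u) u.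
Proof.
move=> bF Lu; apply: le_trans (inner_app_ge bF Lu).
by rewrite mulr_ge0 ?inner_ge0// ltW//; exact: borel_c bF.
Qed.

Lemma bform_ae A F u v : {ae mu, forall x, Y x -> A x = F x} ->
  bform A u v = inner (apply_field F u) v.
Proof.
move=> AF; apply: ae_eq_Rintegral.
by apply: filterS AF => x AF Yx; rewrite /apply_field AF.
Qed.

Lemma inv_field_ae A F : {ae mu, forall x, Y x -> A x = F x} ->
  {ae mu, forall x, Y x -> inv_field A x = inv_field F x}.
Proof. by apply: filterS => x AF Yx; rewrite /inv_field AF. Qed.

Lemma cst_add_lin (E : Rd) e : cst E \+ e = lin (cst E) 1 e.
Proof. by apply/funext => x; rewrite /lin scale1r. Qed.

(** What the variational arguments use of [spaceE] and [spaceJ] alike. *)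
Record fluctuation V : Prop := {
  fluct_L2 : forall e, V e -> L2v e;
  fluct_perp_cst : forall e E, V e -> inner e (cst E) = 0;
  fluct_lin : forall u t v, V u -> V v -> V (lin u t v) }.

Lemma fluctuationE : fluctuation (@spaceE R d).
Proof.
split=> [e|e E|u t v]; [exact: spaceE_L2v|exact: spaceE_perp_cst|exact: spaceE_lin].
Qed.

Lemma fluctuationJ : fluctuation (@spaceJ R d).
Proof.
split=> [e|e E|u t v]; [exact: spaceJ_L2v|exact: spaceJ_perp_cst|exact: spaceJ_lin].
Qed.

Section variational.
Context A F (c C : R) (bF : borel_field c C F).
Context (AF : {ae mu, forall x, Y x -> A x = F x}).
Context V (fV : fluctuation V).

Let L2v_total E e : V e -> L2v (cst E \+ e).
Proof. by move=> Ve; rewrite cst_add_lin; apply: L2v_lin; [exact: L2v_cst|exact: (fluct_L2 fV Ve)]. Qed.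

(** Fluctuations are orthogonal to constants, so the squared norm of [E + e] is at least that of
    [E]. *)
Lemma energy_ge (E : Rd) e : V e ->
  c * dot E E <= bform A (cst E \+ e) (cst E \+ e).
Proof.
move=> Ve; rewrite (bform_ae _ _ AF).
apply: le_trans (inner_app_ge bF (L2v_total E Ve)).
have Le := fluct_L2 fV Ve; have LE := L2v_cst E.
rewrite ler_pM2l; last exact: borel_c bF.
rewrite cst_add_lin inner_sqr_lin// [inner (cst E) e]innerC.
have -> : inner e (cst E) = 0 by exact: (fluct_perp_cst fV).
rewrite mulr0 addr0 expr1n mul1r.
have -> : inner (cst E) (cst E) = dot E E by exact: (@integralY_cst R d (dot E E)).
by rewrite lerDl inner_ge0.
Qed.

(** The energy minus the quadratic form of [M] is nonnegative on all pairs of a mean and a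
    fluctuation, and vanishes at [E], [e]. Its first variation in the joint direction [E'], [e'] is
    therefore zero. *)
Lemma euler_equation (M : 'M[R]_d) (E : Rd) e : homogenized A V M -> V e ->
  dot (M *m E) E = bform A (cst E \+ e) (cst E \+ e) ->
  forall E' e', V e' ->
    inner (apply_field F (cst E \+ e)) (cst E' \+ e') = dot (M *m E) E'.
Proof.
move=> [MT Mmin] Ve eE E' e' Ve'; rewrite (bform_ae _ _ AF) in eE.
have Lu := L2v_total E Ve; have Lu' := L2v_total E' Ve'.
have le G g : V g -> dot (M *m G) G <= inner (apply_field F (cst G \+ g)) (cst G \+ g).
  by move=> Vg; rewrite -(bform_ae _ _ AF); apply: (Mmin G).2; exists g.
apply: subr0_eq; apply: (@quadratic_ge0_linear_eq0 _ _
  (inner (apply_field F (cst E' \+ e')) (cst E' \+ e') - dot (M *m E') E')).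
  by rewrite subr_ge0 le.
move=> t; have := le (E + t *: E') _ (fluct_lin fV t Ve Ve').
rewrite (_ : cst _ \+ lin _ _ _ = lin (cst E \+ e) t (cst E' \+ e')); last first.
  by apply/funext => x; rewrite /lin /= scalerDr addrACA.
rewrite dot_mx_lin// (inner_app_lin _ bF)// eE; lra.
Qed.

Lemma bounds_chain (VN : set (Rd -> Rd)) N A' (M0 M1 M2 : 'M[R]_d) : VN `<=` V ->
  homogenized A V M0 -> homogenizedGa A VN M1 ->
  M2^T = M2 /\ (forall E : Rd, exists2 e : Rd -> Rd,
    is_minimizer VN (fun e' => bformN N A' (cst E \+ e') (cst E \+ e')) e &
    dot (M2 *m E) E = bform A (cst E \+ e) (cst E \+ e)) ->
  lowner_le M0 M1 /\ lowner_le M1 M2.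
Proof.
move=> sub [M0T M0min] [M1T M1inf] [M2T M2b].
have p0 E : c * dot E E <= dot (M0 *m E) E.
  by have [[e Ve <-] _] := M0min E; exact: energy_ge.
have le01 E : dot (M0 *m E) E <= dot (M1 *m E) E.
  rewrite M1inf; apply: lb_le_inf.
    (* The infimum of an empty set would be a default value; the discrete minimizer shows that
       competitors exist. *)
    have [e [VNe _] _] := M2b E; exists (bform A (cst E \+ e) (cst E \+ e)).
    by exists e.
  by move=> _ [e VNe <-]; apply: (M0min E).2; exists e => //; exact: sub.
have le12 E : dot (M1 *m E) E <= dot (M2 *m E) E.
  have [e [VNe _] ->] := M2b E; rewrite M1inf; apply: ge_inf; last by exists e.
  (* The infimum lies below its competitors only if the energies are bounded below, which
     ellipticity provides. *)
  exists (c * dot E E) => _ [e' VNe' <-]; apply: energy_ge; exact: sub.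
have pos E : E != 0 -> 0 < c * dot E E.
  by move=> E0; rewrite mulr_gt0 ?dot_gt0//; exact: borel_c bF.
(* [lowner_le] asks for definiteness on both sides: it comes from ellipticity and passes upwards
   along the inequalities. *)
have s0 : spd M0 by split => // E /pos; move=> /lt_le_trans; exact.
have s1 : spd M1 by split => // E E0; apply: lt_le_trans (le01 E); exact: s0.2.
have s2 : spd M2 by split => // E E0; apply: lt_le_trans (le12 E); exact: s1.2.
by split.
Qed.

End variational.

Lemma homogenized_duality A (AH BH : 'M[R]_d) : coefficient_field A ->
  homogenized A (@spaceE R d) AH -> homogenized (inv_field A) (@spaceJ R d) BH ->
  forall E : Rd, BH *m (AH *m E) = E.
Proof.
move=> hA hAH hBH E.
have [F [c [C [bF AF]]]] := coefficient_field_borel hA.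
have bF' := borel_field_inv bF; have AF' := inv_field_ae AF.
have [[e Ee eE] _] := hAH.2 E.
(* With [e' = 0] this reads off the mean of the flux; with [E' = 0] it tests the flux against
   [spaceE]. *)
have euler := euler_equation bF AF fluctuationE hAH Ee (esym eE).
pose u := cst E \+ e; pose s := apply_field F u; pose J := AH *m E.
have Le := spaceE_L2v Ee.
have Lu : L2v u by rewrite /u cst_add_lin; apply: L2v_lin => //; exact: L2v_cst.
have Ls : L2v s by exact: L2v_apply_field bF Lu.
have LJ := L2v_cst J.
pose j := lin s (-1) (cst J).
have Lj : L2v j by exact: L2v_lin.
have sJj : s = cst J \+ j by apply/funext => x; rewrite /j /lin /= scaleN1r addrC subrK.
have E0 : @spaceE R d (@zero_field R d).
  apply/spaceEP; split=> //.
  - exact: L2v_cst.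
  - by move=> i; rewrite -[RHS](@integralY_cst R d); apply: eq_Rintegral => x _; rewrite mxE.
  - by move=> k th i i'; rewrite !coef_zero !mulr0.
have s_cst E' : inner s (cst E') = dot J E'.
  rewrite -(euler E' _ E0); congr inner; apply/funext => x.
  by rewrite /= addr0.
have s_E g : @spaceE R d g -> inner s g = 0.
  move=> Eg; have := euler 0 g Eg; rewrite dot_mx mulmx0 mxE => <-; congr inner.
  by apply/funext => x; rewrite /= add0r.
have Jj : @spaceJ R d j.
  apply/spaceJP; split => //.
  - apply: Zperiodic_lin => // k x; rewrite /s /apply_field /u/= (borel_periodic bF).
    by have [pe _ _ _] := (spaceEP e).1 Ee; rewrite pe.
  - move=> i; rewrite integral_lin// (@integralY_cst R d (J i 0)).
    have := s_cst (delta_mx i 0); rewrite dot_delta_mx inner_cst// => <-.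
    rewrite (bigD1 i)//= big1 ?addr0; first by rewrite mxE !eqxx mul1r mulN1r subrr.
    by move=> i' ii'; rewrite mxE (negbTE ii') mul0r.
  (* At frequency zero every term vanishes. Otherwise the sum is the product of [j] with a gradient
     wave, to which both [s] and the constant [J] are orthogonal. *)
  - move=> k th; have [->|k0] := eqVneq k 0.
      by apply: big1 => i _; rewrite mxE mul0r.
    have Ek := spaceE_plane_wave th k0.
    have := inner_plane_wave (map_mx intr k) k th Lj.
    under eq_bigr do rewrite mxE; move=> <-.
    have Lk := spaceE_L2v Ek.
    by rewrite inner_linl// s_E// innerC spaceE_perp_cst// mulr0 addr0.
have Fs : apply_field (inv_field F) s = u.
  apply/funext => x; rewrite /apply_field /s /inv_field mulKmx//.
  exact: elliptic_unitmx (borel_c bF) (borel_elliptic bF x).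
have u_J g : @spaceJ R d g -> inner u g = 0.
  move=> Jg; have Lg := spaceJ_L2v Jg; rewrite /u cst_add_lin inner_linl//; last exact: L2v_cst.
  by rewrite innerC spaceJ_perp_cst// spaceE_perp_spaceJ// mulr0 addr0.
have minJ : dot (BH *m J) J = bform (inv_field A) (cst J \+ j) (cst J \+ j).
  apply/eqP; rewrite eq_le; apply/andP; split.
    by apply: (hBH.2 J).2; exists j.
  have [[j' Jj' <-] _] := hBH.2 J; rewrite !(bform_ae _ _ AF').
  (* The field of the dual minimizer [j'] is [s + w]. The cross term of its energy pairs [Fs], that
     is [u], with [w] and vanishes, so the energy of [s] does not exceed the minimum. *)
  pose w := lin j' (-1) j; have Jw : @spaceJ R d w by exact: spaceJ_lin.
  have -> : cst J \+ j' = lin s 1 w.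
    by apply/funext => x; rewrite sJj /w /lin /= scale1r scaleN1r addrA addrAC addrK.
  have Lw := spaceJ_L2v Jw.
  rewrite (inner_app_lin _ bF')// -sJj Fs (u_J _ Jw) mulr0 addr0 expr1n mul1r lerDl.
  exact: inner_app_ge0 bF' Lw.
have euler' := euler_equation bF' AF' fluctuationJ hBH Jj minJ.
(* The dual Euler equation is tested with a unit vector and the zero fluctuation; its left side is
   then a component of the mean of [u], which is [E] because [e] has mean zero. *)
apply/colP => i; rewrite -(dot_delta_mx (BH *m _)) -(euler' _ _ (@spaceJ0 R d)).
rewrite -sJj Fs -[RHS](dot_delta_mx E).
rewrite (_ : cst _ \+ _ = cst (delta_mx i 0)); last by apply/funext => x; rewrite /= addr0.
rewrite /u cst_add_lin inner_linl//; try exact: L2v_cst.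
rewrite (spaceE_perp_cst (delta_mx i 0) Ee) mulr0 addr0.
exact: (@integralY_cst R d (dot E (delta_mx i 0))).
Qed.

End homogenization.

Theorem proposition11 (R : realType) (d : nat) (hd : d = 2%N \/ d = 3%N)
  (A : 'cV[R]_d -> 'M[R]_d) (hA : coefficient_field A)
  (N : 'I_d -> nat) (hN : forall i, odd (N i))
  (AH BH AHN BHN AtN BtN : 'M[R]_d)
  (hAH : homogenized A (@spaceE R d) AH)
  (hBH : homogenized (inv_field A) (@spaceJ R d) BH)
  (hAHN : homogenizedGa A (@spaceEN R d N) AHN)
  (hBHN : homogenizedGa (inv_field A) (@spaceJN R d N) BHN)
  (hAtN : boundGaNi N A (@spaceEN R d N) AtN)
  (hBtN : boundGaNi N (inv_field A) (@spaceJN R d N) BtN) :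
  [/\ lowner_le (invmx BtN) (invmx BHN),
      lowner_le (invmx BHN) (invmx BH),
      invmx BH = AH,
      lowner_le AH AHN
    & lowner_le AHN AtN].
Proof.
have [F [c [C [bF AF]]]] := coefficient_field_borel hA.
have [leA leA'] := bounds_chain bF AF (fluctuationE R d) (@subIsetl _ _ _) hAH hAHN hAtN.
have [leB leB'] := bounds_chain (borel_field_inv bF) (inv_field_ae AF)
  (fluctuationJ R d) (@subIsetl _ _ _) hBH hBHN hBtN.
split => //; [exact: lowner_invmx|exact: lowner_invmx|].
have uB : BH \in unitmx by case: leB => sB _ _; exact: spd_unitmx.
have BA : BH *m AH = 1%:M.
  apply/matrixP => i k; rewrite -[LHS]mulr1 -[AH]mulmx1.
  have := homogenized_duality hA hAH hBH (delta_mx k 0) => /colP/(_ i).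
  by rewrite mulmxA -colE mulr1 mulmx1 !mxE andbT => ->.
by rewrite -[LHS]mulmx1 -BA mulKmx.
Qed.
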